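(* Let $\mathbf{G}=\mathbf{G}(a,b)$. Then $$\Psi_X(0,0;\mathbf{G})=32\,\mathrm{e}^{-\mathrm{i}\arg(ab)}\,\mathfrak{a}\mathfrak{b}\,(\mathfrak{b}^2-\mathfrak{a}^2)=32a^*b^*\frac{|b|^2-|a|^2}{(|a|^2+|b|^2)^2},$$ where $\Psi_X=\partial\Psi/\partial X$, $\mathfrak{a}:=|a|/\sqrt{|a|^2+|b|^2}$ and $\mathfrak{b}:=|b|/\sqrt{|a|^2+|b|^2}$ (the middle expression being read as $0$ if $ab=0$).
   Context: Notation: $*$ is complex conjugation; $\sigma_3=\mathrm{diag}(1,-1)$; $\mathrm{e}^{f\sigma_3}=\mathrm{diag}(\mathrm{e}^{f},\mathrm{e}^{-f})$. For $(a,b)\in\mathbb{C}^2\setminus\{(0,0)\}$ let $$\mathbf{G}(a,b)=\frac{1}{\sqrt{|a|^2+|b|^2}}\begin{bmatrix}a & b^*\\ -b & a^*\end{bmatrix}.$$ For $(X,T)\in\mathbb{R}^2$ and $\mathbf{G}=\mathbf{G}(a,b)$, $\mathbf{P}(\Lambda;X,T,\mathbf{G})$ denotes the unique (it is known to exist) $2\times 2$ matrix function of $\Lambda$ such that: (i) it is analytic for $|\Lambda|\neq 1$ and takes continuous boundary values on the unit circle from the interior and from the exterior; (ii) writing $\mathbf{P}_+$ (resp. $\mathbf{P}_-$) for the boundary value on $|\Lambda|=1$ from the exterior (resp. interior), $$\mathbf{P}_+=\mathbf{P}_-\,\mathrm{e}^{-\mathrm{i}(\Lambda X+\Lambda^2T+2\Lambda^{-1})\sigma_3}\,\mathbf{G}\,\mathrm{e}^{\mathrm{i}(\Lambda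 X+\Lambda^2T+2\Lambda^{-1})\sigma_3},\quad |\Lambda|=1;$$ (iii) $\mathbf{P}\to\mathbb{I}$ as $\Lambda\to\infty$. Then $\Psi(X,T;\mathbf{G}):=2\mathrm{i}\lim_{\Lambda\to\infty}\Lambda P_{12}(\Lambda;X,T,\mathbf{G})$; it is known to be real-analytic in $(X,T)\in\mathbb{R}^2$. *)

(* Defs.v *)
From Stdlib Require Import Reals Lra.
From Coquelicot Require Import Coquelicot.

Open Scope C_scope.

Definition Cexp (z : C) : C :=
  (exp (Re z) * cos (Im z), exp (Re z) * sin (Im z))%R.

(** [t] is a value of the (multivalued) argument of [z]; every [t] is a value
    of the argument of [0]. *)
Definition is_arg (z : C) (t : R) : Prop := z = Cmod z * Cexp (Ci * t).

(** Neighbourhoods of the point at infinity of the complex plane. *)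
Definition C_infty (Q : C -> Prop) : Prop :=
  exists M : R, forall z : C, (M < Cmod z)%R -> Q z.

Global Instance C_infty_filter : ProperFilter C_infty.
Proof.
constructor.
- intros Q [M HM].
  exists (RtoC (Rabs M + 1)).
  apply HM; rewrite Cmod_R.
  pose proof (Rle_abs M); pose proof (Rabs_pos M).
  rewrite (Rabs_pos_eq (Rabs M + 1)); lra.
- constructor.
  + now exists 0%R.
  + intros Q1 Q2 [M1 H1] [M2 H2].
    exists (Rmax M1 M2); intros z Hz; split.
    * apply H1; apply Rle_lt_trans with (2 := Hz); apply Rmax_l.
    * apply H2; apply Rle_lt_trans with (2 := Hz); apply Rmax_r.
  + intros Q1 Q2 H [M HM]; exists M; intros z Hz; apply H, HM, Hz.
Qed.

Definition M2 : Type := @matrix C 2 2.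

Definition mat22 (a b c d : C) : M2 :=
  mk_matrix 2 2 (fun i j =>
    match i, j with
    | 0%nat, 0%nat => a
    | 0%nat, _ => b
    | _, 0%nat => c
    | _, _ => d
    end).

(** Entries are numbered from 0: the (1,2) entry is [entry P 0 1]. *)
Definition entry (A : M2) (i j : nat) : C := coeff_mat (RtoC 0) A i j.

Definition mmul (A B : M2) : M2 := @Mmult C_Ring 2 2 2 A B.

Definition id2 : M2 := @Mone C_Ring 2.

(** [exp (f sigma_3)], where [sigma_3 = diag (1, -1)]. *)
Definition exp_sigma3 (f : C) : M2 := mat22 (Cexp f) 0 0 (Cexp (- f)).

Definition norm2 (a b : C) : R := sqrt (Cmod a ^ 2 + Cmod b ^ 2).

Definition Gmat (a b : C) : M2 :=
  mat22 (a / norm2 a b) (Cconj b / norm2 a b)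
        (- b / norm2 a b) (Cconj a / norm2 a b).

Definition phase (X T : R) (L : C) : C := L * X + L ^ 2 * T + 2 / L.

Definition jump (G : M2) (X T : R) (L : C) : M2 :=
  mmul (exp_sigma3 (- Ci * phase X T L))
       (mmul G (exp_sigma3 (Ci * phase X T L))).

(** Entrywise limit of a matrix-valued function. *)
Definition mlim (P : C -> M2) (F : (C -> Prop) -> Prop) (A : M2) : Prop :=
  forall i j : nat, (i < 2)%nat -> (j < 2)%nat ->
    filterlim (fun L : C => entry (P L) i j) F (locally (entry A i j)).

(** Complex differentiability, at every point of the open set [D], of all the
    entries. *)
Definition analytic_on (D : C -> Prop) (P : C -> M2) : Prop :=
  forall i j : nat, (i < 2)%nat -> (j < 2)%nat ->
    forall L : C, D L ->
      @ex_derive C_AbsRing C_NormedModule (fun z : C => entry (P z) i j) L.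

Definition exterior (L : C) : Prop := (1 < Cmod L)%R.
Definition interior (L : C) : Prop := (Cmod L < 1)%R.
Definition circle (L : C) : Prop := Cmod L = 1%R.

(** [B] is continuous on the unit circle, and is there the boundary value of
    [P] from the side [D]. *)
Definition boundary_value (D : C -> Prop) (P B : C -> M2) : Prop :=
  forall z : C, circle z ->
    mlim P (within D (locally z)) (B z) /\
    mlim B (within circle (locally z)) (B z).

(** The values of [P] on the unit circle itself are left unconstrained: only
    its boundary values [Pp] (exterior) and [Pm] (interior) matter there. *)
Definition RHP_solution (G : M2) (X T : R) (P : C -> M2) : Prop :=
  analytic_on (fun L => Cmod L <> 1%R) P /\
  (exists Pp Pm : C -> M2,
     boundary_value exterior P Pp /\
     boundary_value interior P Pm /\
     (forall L : C, circle L -> Pp L = mmul (Pm L) (jump G X T L))) /\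
  mlim P C_infty id2.

(** [2 i lim_{L -> infinity} L P_12(L)]. *)
Definition Psi_of (P : C -> M2) : C :=
  2 * Ci *
  @iota C_CompleteNormedModule (fun l : C =>
    filterlim (fun L : C => L * entry (P L) 0 1) C_infty (locally l)).

(* Main.v *)
(** Conjugating the jump by [exp (-2 i sigma_3 / Lambda)], which is analytic
    outside the unit circle, makes it constant when [X = T = 0].  For [T = 0] let
    [p] be the first row of [P] and let [E], [D] be the exponentials
    [exp (-2 i sigma_3 / Lambda)] and [exp (-i Lambda X sigma_3)].  The jump
    condition says that on the circle the row [q = p_- D], analytic inside, and
    the row [s = p_+ E G^-1 E^-1], analytic outside with [s -> c], the first row
    of [G^-1], differ by [delta = p_+ (D - 1) E G^-1 E^-1 = O(X)].  Since [q - c]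
    and [s - c] are orthogonal in [L^2] of the circle, [s - c = O(X)] there.
    The coefficient of [1 / Lambda] in [p] is thus known up to [O(X^2)] from that
    of [delta] with [s] replaced by [c], that is, from the [1 / Lambda^2]
    coefficients of [exp (+-4 i / Lambda)], which are both [-8].  The facts
    used about holomorphic functions (mean value over circles, removable
    singularities) come from Goursat's theorem in the variable [log Lambda]. *)
Require Import Defs.
From Stdlib Require Import Reals Lra Lia.
From Coquelicot Require Import Coquelicot.
Open Scope C_scope.

(** * Continuity and differentiability in the complex plane *)

(** The matrices [P X T] are given one by one, with no regularity in [X], so an expansion of [P] in
    [X] cannot be assumed. What is proved is an expansion of [Psi_of (P X 0)] with error at most
    [K * X ^ 2], where [K] and the range of [X] are fixed before any solution is considered; the
    derivative follows from it. The difficulty is circular: [delta] contains the unknown row itself.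
    Working in L^2 resolves this, since orthogonal projection does not increase the norm: the mean U
    of |s - c|^2 satisfies U <= N X^2 (U + 4), and for small [X] the U on the right is absorbed. In
    the supremum norm the corresponding projection is unbounded. All functions are moved to the unit
    disc of w = 1 / Lambda. Inversion carries the outer functions there; the inner ones are
    reflected by conjugation instead, because conj w = 1 / w on the circle. Both kinds are then
    continuous up to the circle and holomorphic inside, so the mean value property suffices for
    orthogonality and for reading off coefficients: the derivative at 0 is the mean of conj w times
    the function. *)

Definition ccont (f : C -> C) (z : C) : Prop :=
  forall eps : R, (0 < eps)%R -> exists d : R, (0 < d)%R /\
    forall w : C, (Cmod (w - z) < d)%R -> (Cmod (f w - f z) < eps)%R.

Lemma ccont_local (f g : C -> C) (z : C) (d : R) :
  (0 < d)%R -> (forall w, (Cmod (w - z) < d)%R -> f w = g w) ->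
  ccont f z -> ccont g z.
Proof.
intros Hd H Hf eps He.
destruct (Hf eps He) as (d1 & Hd1 & H1).
exists (Rmin d d1); split; [now apply Rmin_pos|].
intros w Hw.
rewrite <- (H w), <- (H z).
- apply H1; apply Rlt_le_trans with (1 := Hw), Rmin_r.
- replace (z - z) with (RtoC 0) by ring; now rewrite Cmod_0.
- apply Rlt_le_trans with (1 := Hw), Rmin_l.
Qed.

Lemma ccont_ext (f g : C -> C) (z : C) :
  (forall w, f w = g w) -> ccont f z -> ccont g z.
Proof. intros H; apply (ccont_local f g z 1); auto; lra. Qed.

Lemma ccont_const (c z : C) : ccont (fun _ => c) z.
Proof.
intros eps He; exists 1%R; split; [lra|]; intros w _.
replace (c - c) with (RtoC 0) by ring; now rewrite Cmod_0.
Qed.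

Lemma ccont_id (z : C) : ccont (fun w => w) z.
Proof. intros eps He; exists eps; auto. Qed.

Lemma ccont_comp (f g : C -> C) (z : C) :
  ccont f z -> ccont g (f z) -> ccont (fun w => g (f w)) z.
Proof.
intros Hf Hg eps He.
destruct (Hg eps He) as (d & Hd & H).
destruct (Hf d Hd) as (d' & Hd' & H').
exists d'; split; auto.
Qed.

Lemma ccont_plus (f g : C -> C) (z : C) :
  ccont f z -> ccont g z -> ccont (fun w => f w + g w) z.
Proof.
intros Hf Hg eps He.
destruct (Hf (eps / 2)%R) as (d & Hd & H); [lra|].
destruct (Hg (eps / 2)%R) as (d' & Hd' & H'); [lra|].
exists (Rmin d d'); split; [now apply Rmin_pos|]; intros w Hw.
replace (f w + g w - (f z + g z)) with ((f w - f z) + (g w - g z)) by ring.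
apply Rle_lt_trans with (1 := Cmod_triangle _ _).
pose proof (Rmin_l d d'); pose proof (Rmin_r d d').
specialize (H w); specialize (H' w); lra.
Qed.

Lemma ccont_mult (f g : C -> C) (z : C) :
  ccont f z -> ccont g z -> ccont (fun w => f w * g w) z.
Proof.
intros Hf Hg eps He.
set (A := (1 + Cmod (f z) + Cmod (g z))%R).
assert (HA : (1 <= A)%R).
{ pose proof (Cmod_ge_0 (f z)); pose proof (Cmod_ge_0 (g z)); unfold A; lra. }
set (e := Rmin 1 (eps / (2 * A))).
assert (He' : (0 < e)%R).
{ apply Rmin_pos; [lra|]; apply Rdiv_lt_0_compat; lra. }
destruct (Hf e He') as (d & Hd & H).
destruct (Hg e He') as (d' & Hd' & H').
exists (Rmin d d'); split; [now apply Rmin_pos|]; intros w Hw.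
pose proof (Rmin_l d d'); pose proof (Rmin_r d d').
specialize (H w ltac:(lra)); specialize (H' w ltac:(lra)).
replace (f w * g w - f z * g z)
  with ((f w - f z) * (g w - g z) + (f z * (g w - g z) + (f w - f z) * g z)) by ring.
assert (He1 : (e <= 1)%R) by apply Rmin_l.
assert (He2 : (e * (2 * A) <= eps)%R).
{ apply (Rmult_le_reg_r (/ (2 * A))); [apply Rinv_0_lt_compat; lra|].
  rewrite Rmult_assoc, Rinv_r, Rmult_1_r by lra; apply Rmin_r. }
apply Rle_lt_trans with (1 := Cmod_triangle _ _).
eapply Rle_lt_trans; [apply Rplus_le_compat_l, Cmod_triangle|].
rewrite !Cmod_mult.
pose proof (Cmod_ge_0 (f z)); pose proof (Cmod_ge_0 (g z)).
pose proof (Cmod_ge_0 (f w - f z)); pose proof (Cmod_ge_0 (g w - g z)).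
unfold A in *; nra.
Qed.

Lemma ccont_opp (f : C -> C) (z : C) : ccont f z -> ccont (fun w => - f w) z.
Proof.
intros Hf; apply ccont_ext with (fun w => -(1) * f w); [intros; ring|].
apply ccont_mult; [apply ccont_const|exact Hf].
Qed.

Lemma ccont_minus (f g : C -> C) (z : C) :
  ccont f z -> ccont g z -> ccont (fun w => f w - g w) z.
Proof. intros Hf Hg; apply ccont_plus; [exact Hf|now apply ccont_opp]. Qed.

Lemma ccont_conj (f : C -> C) (z : C) : ccont f z -> ccont (fun w => Cconj (f w)) z.
Proof.
intros Hf eps He; destruct (Hf eps He) as (d & Hd & H).
exists d; split; auto; intros w Hw.
rewrite <- Cminus_conj, Cmod_conj; auto.
Qed.

Lemma Cmod_reverse_triangle (z w : C) : (Rabs (Cmod z - Cmod w) <= Cmod (z - w))%R.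
Proof.
pose proof (Cmod_triangle (z - w) w) as H.
pose proof (Cmod_triangle (w - z) z) as H'.
replace (z - w + w) with z in H by ring.
replace (w - z + z) with w in H' by ring.
replace (w - z) with (- (z - w)) in H' by ring.
rewrite Cmod_opp in H'.
apply Rabs_le; lra.
Qed.

Lemma ccont_Cmod (f : C -> C) (z : C) :
  ccont f z -> ccont (fun w => RtoC (Cmod (f w))) z.
Proof.
intros Hf eps He; destruct (Hf eps He) as (d & Hd & H).
exists d; split; auto; intros w Hw.
rewrite <- RtoC_minus, Cmod_R.
apply Rle_lt_trans with (2 := H w Hw), Cmod_reverse_triangle.
Qed.

Lemma ccont_inv_id (z : C) : z <> 0 -> ccont Cinv z.
Proof.
intros Hz eps He.
assert (Hz' : (0 < Cmod z)%R) by now apply Cmod_gt_0.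
exists (Rmin (Cmod z / 2) (eps * (Cmod z * Cmod z) / 2)); split.
{ apply Rmin_pos; [lra|]; apply Rdiv_lt_0_compat; [|lra]; repeat apply Rmult_lt_0_compat; lra. }
intros w Hw.
pose proof (Rmin_l (Cmod z / 2) (eps * (Cmod z * Cmod z) / 2)).
pose proof (Rmin_r (Cmod z / 2) (eps * (Cmod z * Cmod z) / 2)).
pose proof (Cmod_reverse_triangle w z) as Ht.
apply Rabs_le_between in Ht.
assert (Hw0 : (Cmod z / 2 < Cmod w)%R) by lra.
assert (Hw' : w <> 0) by (apply Cmod_gt_0; lra).
replace (/ w - / z) with (- (w - z) * / (w * z)) by (field; now split).
rewrite Cmod_mult, Cmod_opp, Cmod_inv, Cmod_mult by now apply Cmult_neq_0.
assert (0 < Cmod w * Cmod z)%R by nra.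
apply (Rmult_lt_reg_r (Cmod w * Cmod z)); [assumption|].
rewrite Rmult_assoc, Rinv_l, Rmult_1_r by lra.
assert (eps * (Cmod z * Cmod z) / 2 <= eps * (Cmod w * Cmod z))%R; [|lra].
replace (eps * (Cmod z * Cmod z) / 2)%R with (eps * (Cmod z / 2 * Cmod z))%R by field.
apply Rmult_le_compat_l; [lra|]; apply Rmult_le_compat_r; lra.
Qed.

Lemma ccont_inv (f : C -> C) (z : C) :
  ccont f z -> f z <> 0 -> ccont (fun w => / f w) z.
Proof. intros Hf Hz; apply ccont_comp; [exact Hf|now apply ccont_inv_id]. Qed.

Lemma Cmod_le_Re_Im (z : C) : (Cmod z <= Rabs (Re z) + Rabs (Im z))%R.
Proof.
pose proof (Rabs_pos (Re z)); pose proof (Rabs_pos (Im z)).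
apply Rsqr_incr_0_var; [|lra].
unfold Rsqr; replace (Cmod z * Cmod z)%R with (Cmod z ^ 2)%R by ring.
rewrite Cmod2_alt, <- (pow2_abs (Re z)), <- (pow2_abs (Im z)); nra.
Qed.

Lemma im_le_Cmod (z : C) : (Rabs (Im z) <= Cmod z)%R.
Proof.
apply Rle_trans with (2 := Rmax_Cmod z); apply Rmax_r.
Qed.

(** * The complex exponential and its Taylor bounds at 0 *)

Lemma Cexp_plus (z w : C) : Cexp (z + w) = Cexp z * Cexp w.
Proof.
unfold Cexp; rewrite re_plus, im_plus, exp_plus, cos_plus, sin_plus.
apply injective_projections; simpl; ring.
Qed.

Lemma Cexp_0 : Cexp 0 = 1.
Proof.
unfold Cexp; simpl; rewrite exp_0, cos_0, sin_0.
apply injective_projections; simpl; ring.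
Qed.

Lemma Cexp_neq_0 (z : C) : Cexp z <> 0.
Proof.
intros H; apply C1_nz.
rewrite <- Cexp_0; replace (RtoC 0) with (z + - z) by ring.
rewrite Cexp_plus, H; ring.
Qed.

Lemma Cexp_opp (z : C) : Cexp (- z) = / Cexp z.
Proof.
pose proof (Cexp_neq_0 z) as Hz.
transitivity (/ Cexp z * (Cexp z * Cexp (- z))); [now field|].
rewrite <- Cexp_plus; replace (z + - z) with (RtoC 0) by ring.
rewrite Cexp_0; ring.
Qed.

Lemma Cexp_conj (z : C) : Cconj (Cexp z) = Cexp (Cconj z).
Proof.
unfold Cexp; rewrite re_conj, im_conj, cos_neg, sin_neg.
apply injective_projections; simpl; ring.
Qed.

Lemma Cmod_Cexp (z : C) : Cmod (Cexp z) = exp (Re z).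
Proof.
unfold Cexp, Cmod; simpl.
replace (_ + _)%R with ((exp (Re z))²)%R.
- apply sqrt_Rsqr, Rlt_le, exp_pos.
- pose proof (sin2_cos2 (Im z)) as H; unfold Rsqr, Im, Re in *.
  transitivity (exp (fst z) * exp (fst z) * (sin (snd z) * sin (snd z) + cos (snd z) * cos (snd z)))%R.
  + rewrite H; ring.
  + ring.
Qed.

Lemma abs_sin_le (y : R) : (Rabs (sin y) <= Rabs y)%R.
Proof.
pose proof (bounded_variation sin cos 1 0 y) as H.
rewrite sin_0, !Rminus_0_r, Rmult_1_l in H; apply H.
intros t _; split; [apply is_derive_Reals, derivable_pt_lim_sin|].
apply Rabs_le, COS_bound.
Qed.

Lemma one_minus_cos_bound (y : R) : (0 <= 1 - cos y <= y ^ 2 / 2)%R.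
Proof.
split; [pose proof (COS_bound y); lra|].
replace y with (2 * (y / 2))%R at 1 by field.
rewrite cos_2a_sin.
pose proof (abs_sin_le (y / 2)) as H.
apply Rsqr_le_abs_1 in H; unfold Rsqr in H; lra.
Qed.

(** The derivative [cos t - 1] is at most [y ^ 2 / 2] in absolute value between 0 and [y]. The
    resulting cubic bound is weakened, as only second order is needed. *)
Lemma sin_minus_id_bound (y : R) : (Rabs y <= 1 -> Rabs (sin y - y) <= y ^ 2)%R.
Proof.
intros Hy.
pose proof (bounded_variation (fun t => sin t - t)%R (fun t => cos t - 1)%R (y ^ 2 / 2) 0 y) as H.
cbv beta in H; rewrite sin_0, !Rminus_0_r in H.
apply Rle_trans with (1 := H ltac:(
  intros t Ht; split;
  [ auto_derive; [exact I|ring]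
  | rewrite Rminus_0_r in Ht; pose proof (one_minus_cos_bound t);
    apply Rsqr_le_abs_1 in Ht; unfold Rsqr in Ht;
    rewrite Rabs_left1 by lra; lra ])).
pose proof (Rabs_pos y); rewrite <- (pow2_abs y); nra.
Qed.

(** Both sides come from [1 + x <= exp x]: applied to [- x] it gives [exp x * (1 - x) <= 1], and [(1
    + x + 2 * x ^ 2) * (1 - x) = 1 + x ^ 2 * (1 - 2 * x)] is at least 1. *)
Lemma exp_taylor1 (x : R) : (Rabs x <= 1 / 2 -> Rabs (exp x - 1 - x) <= 2 * x ^ 2)%R.
Proof.
intros Hx; apply Rabs_le_between in Hx.
pose proof (exp_ineq1_le x); pose proof (exp_ineq1_le (- x)) as H'.
rewrite Rabs_pos_eq by lra.
assert (E : (exp x * exp (- x) = 1)%R) by (rewrite <- exp_plus, Rplus_opp_r; apply exp_0).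
assert (exp x * (1 - x) <= 1)%R.
{ rewrite <- E; apply Rmult_le_compat_l; [apply Rlt_le, exp_pos|lra]. }
assert (exp x <= 1 + x + 2 * x ^ 2)%R; [|lra].
apply (Rmult_le_reg_r (1 - x)); [lra|].
apply Rle_trans with 1%R; [assumption|].
nra.
Qed.

(** The real part is split as [(exp x - 1 - x) - exp x * (1 - cos y)] and the imaginary part as
    [(exp x - 1) * sin y + (sin y - y)], so that every piece is of second order. The pieces add up
    to at most 6 |z|^2; the constant 8 is not sharp. *)
Lemma Cexp_taylor1 (z : C) :
  (Cmod z <= 1 / 2 -> Cmod (Cexp z - 1 - z) <= 8 * Cmod z ^ 2)%R.
Proof.
intros Hz.
set (x := Re z); set (y := Im z).
assert (Hx : (Rabs x <= Cmod z)%R) by apply re_le_Cmod.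
assert (Hy : (Rabs y <= Cmod z)%R) by apply im_le_Cmod.
pose proof (exp_taylor1 x ltac:(lra)) as Ex.
pose proof (one_minus_cos_bound y) as Cy.
pose proof (sin_minus_id_bound y ltac:(lra)) as Sy.
pose proof (abs_sin_le y) as Sy'.
pose proof (Rabs_pos x); pose proof (Rabs_pos y).
rewrite <- (pow2_abs x) in Ex; rewrite <- (pow2_abs y) in Cy, Sy.
apply Rle_trans with (1 := Cmod_le_Re_Im _).
assert (R1 : (Rabs (exp x - 1) <= 2 * Rabs x)%R).
{ replace (exp x - 1)%R with ((exp x - 1 - x) + x)%R by ring.
  apply Rle_trans with (1 := Rabs_triang _ _); nra. }
assert (R2 : (exp x <= 2)%R).
{ apply Rabs_le_between in R1; lra. }
replace (Re (Cexp z - 1 - z)) with ((exp x - 1 - x) + - (exp x * (1 - cos y)))%R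
  by (unfold x, y, Cexp, Re, Im; simpl; ring).
replace (Im (Cexp z - 1 - z)) with ((exp x - 1) * sin y + (sin y - y))%R
  by (unfold x, y, Cexp, Re, Im; simpl; ring).
assert (T1 : (Rabs (exp x - 1 - x + - (exp x * (1 - cos y))) <= 2 * Rabs x ^ 2 + Rabs y ^ 2)%R).
{ apply Rle_trans with (1 := Rabs_triang _ _).
  rewrite Rabs_Ropp, (Rabs_pos_eq (exp x * _)) by (pose proof (exp_pos x); nra).
  pose proof (exp_pos x); nra. }
assert (T2 : (Rabs ((exp x - 1) * sin y + (sin y - y)) <= 2 * Rabs x * Rabs y + Rabs y ^ 2)%R).
{ apply Rle_trans with (1 := Rabs_triang _ _).
  rewrite Rabs_mult.
  apply Rplus_le_compat; [|assumption].
  apply Rmult_le_compat; auto using Rabs_pos. }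
pose proof (Cmod_ge_0 z).
assert (Rabs x ^ 2 <= Cmod z ^ 2)%R by nra.
assert (Rabs y ^ 2 <= Cmod z ^ 2)%R by nra.
assert (Rabs x * Rabs y <= Cmod z ^ 2)%R by nra.
lra.
Qed.

Lemma Cexp_taylor0 (z : C) : (Cmod z <= 1 / 2 -> Cmod (Cexp z - 1) <= 5 * Cmod z)%R.
Proof.
intros Hz; pose proof (Cexp_taylor1 z Hz) as H; pose proof (Cmod_ge_0 z).
replace (Cexp z - 1) with ((Cexp z - 1 - z) + z) by ring.
apply Rle_trans with (1 := Cmod_triangle _ _); nra.
Qed.

(** Carathéodory's form of complex differentiability. *)
Definition cderiv (f : C -> C) (z l : C) : Prop :=
  exists phi : C -> C, ccont phi z /\ phi z = l /\ exists d : R, (0 < d)%R /\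
    forall w, (Cmod (w - z) < d)%R -> f w = f z + phi w * (w - z).

Lemma Cmod_minus_self (z : C) (d : R) : (0 < d)%R -> (Cmod (z - z) < d)%R.
Proof. intros H; replace (z - z) with (RtoC 0) by ring; now rewrite Cmod_0. Qed.

Lemma cderiv_local (f g : C -> C) (z l : C) (d : R) :
  (0 < d)%R -> (forall w, (Cmod (w - z) < d)%R -> f w = g w) ->
  cderiv f z l -> cderiv g z l.
Proof.
intros Hd H (phi & Hc & Hl & d1 & Hd1 & H1).
exists phi; repeat split; auto.
exists (Rmin d d1); split; [now apply Rmin_pos|]; intros w Hw.
pose proof (Rmin_l d d1); pose proof (Rmin_r d d1).
rewrite <- (H w), <- (H z) by (try apply Cmod_minus_self; lra).
apply H1; lra.
Qed.

Lemma cderiv_ccont (f : C -> C) (z l : C) : cderiv f z l -> ccont f z.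
Proof.
intros (phi & Hc & Hl & d & Hd & H).
apply (ccont_local (fun w => f z + phi w * (w - z)) f z d Hd).
- intros w Hw; symmetry; auto.
- apply ccont_plus; [apply ccont_const|]; apply ccont_mult; [exact Hc|].
  apply ccont_minus; [apply ccont_id|apply ccont_const].
Qed.

Lemma cderiv_const (c z : C) : cderiv (fun _ => c) z 0.
Proof.
exists (fun _ => 0); split; [apply ccont_const|]; split; auto.
exists 1%R; split; [lra|]; intros; ring.
Qed.

Lemma cderiv_id (z : C) : cderiv (fun w => w) z 1.
Proof.
exists (fun _ => 1); split; [apply ccont_const|]; split; auto.
exists 1%R; split; [lra|]; intros; ring.
Qed.

Lemma cderiv_plus (f g : C -> C) (z l m : C) :
  cderiv f z l -> cderiv g z m -> cderiv (fun w => f w + g w) z (l + m).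
Proof.
intros (phi & Hc & Hl & d & Hd & H) (psi & Hc' & Hl' & d' & Hd' & H').
exists (fun w => phi w + psi w); split; [now apply ccont_plus|].
split; [now rewrite Hl, Hl'|].
exists (Rmin d d'); split; [now apply Rmin_pos|]; intros w Hw.
pose proof (Rmin_l d d'); pose proof (Rmin_r d d').
rewrite (H w), (H' w) by lra; ring.
Qed.

Lemma cderiv_mult (f g : C -> C) (z l m : C) :
  cderiv f z l -> cderiv g z m -> cderiv (fun w => f w * g w) z (l * g z + f z * m).
Proof.
intros Hf Hg.
pose proof (cderiv_ccont _ _ _ Hf) as Hcf.
destruct Hf as (phi & Hc & Hl & d & Hd & H), Hg as (psi & Hc' & Hl' & d' & Hd' & H').
exists (fun w => phi w * g z + f w * psi w); split.
{ apply ccont_plus; apply ccont_mult; auto using ccont_const. }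
split; [now rewrite Hl, Hl'|].
exists (Rmin d d'); split; [now apply Rmin_pos|]; intros w Hw.
pose proof (Rmin_l d d'); pose proof (Rmin_r d d').
rewrite (H w), (H' w) by lra; ring.
Qed.

Lemma cderiv_comp (f g : C -> C) (z l m : C) :
  cderiv f z l -> cderiv g (f z) m -> cderiv (fun w => g (f w)) z (m * l).
Proof.
intros Hf Hg.
pose proof (cderiv_ccont _ _ _ Hf) as Hcf.
destruct Hf as (phi & Hc & Hl & d & Hd & H), Hg as (psi & Hc' & Hl' & d' & Hd' & H').
exists (fun w => psi (f w) * phi w); split.
{ apply ccont_mult; [now apply ccont_comp|exact Hc]. }
split; [now rewrite Hl, Hl'|].
destruct (Hcf d' Hd') as (d2 & Hd2 & H2).
exists (Rmin d d2); split; [now apply Rmin_pos|]; intros w Hw.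
pose proof (Rmin_l d d2); pose proof (Rmin_r d d2).
rewrite (H' (f w)) by (apply H2; lra).
replace (f w - f z) with (phi w * (w - z)) by (rewrite (H w) by lra; ring).
ring.
Qed.

Lemma cderiv_scal (c : C) (f : C -> C) (z l : C) :
  cderiv f z l -> cderiv (fun w => c * f w) z (c * l).
Proof.
intros H; pose proof (cderiv_mult _ _ _ _ _ (cderiv_const c z) H) as H'.
now replace (c * l) with (0 * f z + c * l) by ring.
Qed.

Lemma cderiv_minus (f g : C -> C) (z l m : C) :
  cderiv f z l -> cderiv g z m -> cderiv (fun w => f w - g w) z (l - m).
Proof.
intros Hf Hg.
apply (cderiv_local (fun w => f w + -(1) * g w) _ z _ 1); [lra|intros; ring|].
replace (l - m) with (l + -(1) * m) by ring.
apply cderiv_plus; [exact Hf|now apply cderiv_scal].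
Qed.

Lemma cderiv_inv (z : C) : z <> 0 -> cderiv Cinv z (- / (z * z)).
Proof.
intros Hz.
exists (fun w => - / (w * z)); split.
{ apply ccont_opp, ccont_inv; [|now apply Cmult_neq_0].
  apply ccont_mult; [apply ccont_id|apply ccont_const]. }
split; [reflexivity|].
apply Cmod_gt_0 in Hz as Hz'.
exists (Cmod z); split; [assumption|]; intros w Hw.
assert (w <> 0).
{ intros ->; replace (0 - z) with (- z) in Hw by ring; rewrite Cmod_opp in Hw; lra. }
field; now split.
Qed.

Lemma cderiv_Cexp (z : C) : cderiv Cexp z (Cexp z).
Proof.
(* The slope function of [Cexp] at 0; by the addition formula the slope at [z] is
   [Cexp z * E1 (w - z)], so continuity is only to be checked at 0. *)
set (E1 := fun h => if Ceq_dec h 0 then RtoC 1 else (Cexp h - 1) / h).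
assert (E1_0 : E1 0 = 1) by (unfold E1; destruct (Ceq_dec 0 0); congruence).
assert (HE : ccont E1 0).
{ intros eps He.
  exists (Rmin (1 / 2) (eps / 8)); split; [apply Rmin_pos; lra|].
  intros w Hw; rewrite E1_0.
  pose proof (Rmin_l (1 / 2) (eps / 8)); pose proof (Rmin_r (1 / 2) (eps / 8)).
  replace (w - 0) with w in Hw by ring.
  unfold E1; destruct (Ceq_dec w 0) as [->|Hw0]; [now apply Cmod_minus_self|].
  replace ((Cexp w - 1) / w - 1) with ((Cexp w - 1 - w) * / w) by now field.
  assert (Hp := proj1 (Cmod_gt_0 w) Hw0).
  rewrite Cmod_mult, Cmod_inv by assumption.
  apply (Rmult_lt_reg_r (Cmod w)); [assumption|].
  rewrite Rmult_assoc, Rinv_l, Rmult_1_r by lra.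
  apply Rle_lt_trans with (1 := Cexp_taylor1 w ltac:(lra)); nra. }
exists (fun w => Cexp z * E1 (w - z)); split.
{ apply ccont_mult; [apply ccont_const|].
  apply (ccont_comp (fun w => w - z)).
  - apply ccont_minus; [apply ccont_id|apply ccont_const].
  - now replace (z - z) with (RtoC 0) by ring. }
split.
{ replace (z - z) with (RtoC 0) by ring; rewrite E1_0; ring. }
exists 1%R; split; [lra|]; intros w _.
unfold E1; destruct (Ceq_dec (w - z) 0) as [Hw|Hw].
- rewrite Hw; replace w with z; [ring|]; symmetry; now apply Ceq_minus.
- replace w with (z + (w - z)) at 1 by ring; rewrite Cexp_plus; field; assumption.
Qed.

Lemma ccont_Cexp (f : C -> C) (z : C) : ccont f z -> ccont (fun w => Cexp (f w)) z.
Proof. intros H; apply ccont_comp; [exact H|]; eapply cderiv_ccont, cderiv_Cexp. Qed.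

(** Reflection in the real axis preserves holomorphy; this is what turns functions inside the circle
    into functions of w read at Lambda = conj w. *)
Lemma cderiv_conj_conj (f : C -> C) (z l : C) :
  cderiv f (Cconj z) l -> cderiv (fun w => Cconj (f (Cconj w))) z (Cconj l).
Proof.
intros (phi & Hc & Hl & d & Hd & H).
exists (fun w => Cconj (phi (Cconj w))); split.
{ apply ccont_conj, ccont_comp; [apply ccont_conj, ccont_id|exact Hc]. }
split; [now rewrite Hl|].
exists d; split; auto; intros w Hw.
rewrite (H (Cconj w)), Cplus_conj, Cmult_conj, Cminus_conj, !Cconj_conj; [reflexivity|].
now rewrite <- Cminus_conj, Cmod_conj.
Qed.

Lemma cderiv_of_derive (f : C -> C) (z : C) :
  @ex_derive C_AbsRing C_NormedModule f z -> exists l, cderiv f z l.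
Proof.
intros [l [_ Hl]]; exists l.
specialize (Hl z (fun P H => H)).
set (phi := fun w => if Ceq_dec w z then l else (f w - f z) / (w - z)).
assert (Hz : phi z = l) by (unfold phi; destruct (Ceq_dec z z); congruence).
exists phi; split; [|split; [exact Hz|]].
- intros eps He.
  assert (He2 : (0 < eps / 2)%R) by lra.
  destruct (Hl (mkposreal _ He2)) as [d Hd].
  exists d; split; [apply cond_pos|]; intros w Hw.
  rewrite Hz; unfold phi; destruct (Ceq_dec w z) as [->|Hwz]; [now apply Cmod_minus_self|].
  assert (Hn : w - z <> 0) by now apply Cminus_eq_contra.
  specialize (Hd w Hw); simpl in Hd.
  replace ((f w - f z) / (w - z) - l) with ((f w - f z - (w - z) * l) * / (w - z)) by now field.
  rewrite Cmod_mult, Cmod_inv by assumption.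
  apply Cmod_gt_0 in Hn.
  apply (Rmult_lt_reg_r (Cmod (w - z))); [assumption|].
  rewrite Rmult_assoc, Rinv_l, Rmult_1_r by lra.
  eapply Rle_lt_trans; [exact Hd|].
  change (eps / 2 * Cmod (w - z) < eps * Cmod (w - z))%R; nra.
- exists 1%R; split; [lra|]; intros w _.
  unfold phi; destruct (Ceq_dec w z) as [->|Hwz]; [ring|].
  field; now apply Cminus_eq_contra.
Qed.

(** * Integrals and Goursat's theorem *)

Definition gcont (f : C -> C) : Prop := forall z, ccont f z.

(** Only the values of [h] on the real axis matter; functions of a complex
    variable are integrated so that [gcont] covers every integrand. *)
Definition CInt (h : C -> C) (a b : R) : C :=
  (RInt (fun t : R => Re (h t)) a b, RInt (fun t : R => Im (h t)) a b).

Lemma gcont_Re (h : C -> C) (t : R) :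
  gcont h -> continuous (fun t : R => Re (h t)) t.
Proof.
intros Hh; apply continuity_pt_filterlim; intros eps He.
destruct (Hh (RtoC t) eps He) as (d & Hd & H).
exists d; split; [exact Hd|]; intros u [_ Hu].
simpl in Hu |- *; unfold R_dist in *.
change (Re (h u) - Re (h t))%R with (Re (h u - h t)).
apply Rle_lt_trans with (1 := re_le_Cmod _), H.
now rewrite <- RtoC_minus, Cmod_R.
Qed.

Lemma gcont_Im (h : C -> C) (t : R) :
  gcont h -> continuous (fun t : R => Im (h t)) t.
Proof.
intros Hh; apply continuity_pt_filterlim; intros eps He.
destruct (Hh (RtoC t) eps He) as (d & Hd & H).
exists d; split; [exact Hd|]; intros u [_ Hu].
simpl in Hu |- *; unfold R_dist in *.
change (Im (h u) - Im (h t))%R with (Im (h u - h t)).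
apply Rle_lt_trans with (1 := im_le_Cmod _), H.
now rewrite <- RtoC_minus, Cmod_R.
Qed.

Lemma gcont_ex_RInt_Re (h : C -> C) (a b : R) :
  gcont h -> ex_RInt (fun t : R => Re (h t)) a b.
Proof. intros Hh; apply (@ex_RInt_continuous R_CompleteNormedModule); intros; now apply gcont_Re. Qed.

Lemma gcont_ex_RInt_Im (h : C -> C) (a b : R) :
  gcont h -> ex_RInt (fun t : R => Im (h t)) a b.
Proof. intros Hh; apply (@ex_RInt_continuous R_CompleteNormedModule); intros; now apply gcont_Im. Qed.

Lemma CInt_ext (g h : C -> C) (a b : R) :
  (forall t : R, Rmin a b < t < Rmax a b -> g t = h t)%R -> CInt g a b = CInt h a b.
Proof.
intros H; unfold CInt; f_equal; apply RInt_ext; intros t Ht; now rewrite H.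
Qed.

Lemma CInt_plus (g h : C -> C) (a b : R) :
  gcont g -> gcont h -> CInt (fun z => g z + h z) a b = CInt g a b + CInt h a b.
Proof.
intros Hg Hh; unfold CInt, Cplus; simpl; f_equal.
- apply (@RInt_plus R_CompleteNormedModule (fun t : R => Re (g t)) (fun t : R => Re (h t)));
    now apply gcont_ex_RInt_Re.
- apply (@RInt_plus R_CompleteNormedModule (fun t : R => Im (g t)) (fun t : R => Im (h t)));
    now apply gcont_ex_RInt_Im.
Qed.

Lemma RInt_lin (f g : R -> R) (a b k l : R) :
  ex_RInt f a b -> ex_RInt g a b ->
  RInt (fun t => k * f t + l * g t)%R a b = (k * RInt f a b + l * RInt g a b)%R.
Proof.
intros Hf Hg.
apply (@is_RInt_unique R_CompleteNormedModule).
apply (@is_RInt_plus R_NormedModule); apply (@is_RInt_scal R_NormedModule);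
  now apply (@RInt_correct R_CompleteNormedModule).
Qed.

Lemma CInt_scal (c : C) (h : C -> C) (a b : R) :
  gcont h -> CInt (fun z => c * h z) a b = c * CInt h a b.
Proof.
intros Hh.
pose proof (gcont_ex_RInt_Re h a b Hh) as Hr.
pose proof (gcont_ex_RInt_Im h a b Hh) as Hi.
unfold CInt; rewrite (surjective_pairing (c * _)); f_equal; simpl.
- rewrite <- (RInt_ext (fun t : R => Re c * Re (h t) + (- Im c) * Im (h t))%R).
  + rewrite RInt_lin by assumption; unfold Re, Im; ring.
  + intros t _; unfold Re, Im; simpl; ring.
- rewrite <- (RInt_ext (fun t : R => Re c * Im (h t) + Im c * Re (h t))%R).
  + rewrite RInt_lin by assumption; unfold Re, Im; ring.
  + intros t _; unfold Re, Im; simpl; ring.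
Qed.

Lemma CInt_minus (g h : C -> C) (a b : R) :
  gcont g -> gcont h -> CInt (fun z => g z - h z) a b = CInt g a b - CInt h a b.
Proof.
intros Hg Hh.
rewrite (CInt_ext _ (fun z => g z + -(1) * h z)) by (intros; ring).
rewrite CInt_plus, CInt_scal; auto; [ring|].
intros z; apply ccont_mult; [apply ccont_const|apply Hh].
Qed.

Lemma CInt_conj (h : C -> C) (a b : R) :
  gcont h -> CInt (fun z => Cconj (h z)) a b = Cconj (CInt h a b).
Proof.
intros Hh; unfold CInt; rewrite (surjective_pairing (Cconj _)); f_equal; simpl.
apply (@is_RInt_unique R_CompleteNormedModule).
apply (@is_RInt_opp R_NormedModule), (@RInt_correct R_CompleteNormedModule).
now apply gcont_ex_RInt_Im.
Qed.

Lemma CInt_Chasles (h : C -> C) (a b c : R) :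
  gcont h -> CInt h a b + CInt h b c = CInt h a c.
Proof.
intros Hh; unfold CInt, Cplus; simpl; f_equal.
- apply (@RInt_Chasles R_CompleteNormedModule); now apply gcont_ex_RInt_Re.
- apply (@RInt_Chasles R_CompleteNormedModule); now apply gcont_ex_RInt_Im.
Qed.

(** Real and imaginary parts are estimated separately, whence the factor 2, which is harmless since
    only orders of magnitude in [X] matter. *)
Lemma CInt_bound (h g : C -> C) (a b : R) :
  gcont h -> gcont g -> (a <= b)%R ->
  (forall t : R, (a <= t <= b)%R -> (Cmod (h t) <= Re (g t))%R) ->
  (Cmod (CInt h a b) <= 2 * Re (CInt g a b))%R.
Proof.
intros Hh Hg Hab H.
pose proof (gcont_ex_RInt_Re h a b Hh) as Hr.
pose proof (gcont_ex_RInt_Im h a b Hh) as Hi.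
pose proof (gcont_ex_RInt_Re g a b Hg) as Hgr.
apply Rle_trans with (1 := Cmod_le_Re_Im _); simpl.
assert (forall f : R -> R, ex_RInt f a b ->
  (forall t, (a <= t <= b)%R -> (Rabs (f t) <= Re (g t))%R) ->
  (Rabs (RInt f a b) <= RInt (fun t : R => Re (g t)) a b)%R) as HR.
{ intros f Hf Hb.
  apply (@norm_RInt_le R_NormedModule f (fun t : R => Re (g t)) a b);
    [exact Hab|exact Hb| |]; now apply (@RInt_correct R_CompleteNormedModule). }
pose proof (HR _ Hr) as H1; pose proof (HR _ Hi) as H2.
unfold CInt, Re, Im in *; simpl.
rewrite double; apply Rplus_le_compat; [apply H1|apply H2]; intros t Ht;
  apply Rle_trans with (2 := H t Ht); [apply re_le_Cmod|apply im_le_Cmod].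
Qed.

Lemma CInt_le (f g : C -> C) (a b : R) :
  gcont f -> gcont g -> (a <= b)%R ->
  (forall t : R, (a < t < b)%R -> (Re (f t) <= Re (g t))%R) ->
  (Re (CInt f a b) <= Re (CInt g a b))%R.
Proof.
intros Hf Hg Hab H; apply RInt_le; auto; now apply gcont_ex_RInt_Re.
Qed.

Lemma CInt_const (c : C) (a b : R) : CInt (fun _ => c) a b = (b - a)%R * c.
Proof.
unfold CInt; rewrite !(@RInt_const R_CompleteNormedModule).
apply injective_projections; simpl; unfold scal; simpl; unfold mult, Re, Im; simpl; ring.
Qed.

Lemma CInt_const_bound (h : C -> C) (a b M : R) :
  gcont h -> (a <= b)%R -> (forall t : R, (a <= t <= b)%R -> (Cmod (h t) <= M)%R) ->
  (Cmod (CInt h a b) <= 2 * ((b - a) * M))%R.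
Proof.
intros Hh Hab H.
apply Rle_trans with (1 := CInt_bound h (fun _ => RtoC M) a b Hh (fun z => ccont_const _ z) Hab H).
rewrite CInt_const, <- RtoC_mult; simpl; lra.
Qed.

Lemma cderiv_Re_derive (H : C -> C) (t : R) (l : C) :
  cderiv H t l -> is_derive (fun t : R => Re (H t)) t (Re l).
Proof.
intros (phi & Hc & Hl & d & Hd & HH).
apply is_derive_Reals; intros eps He.
destruct (Hc eps He) as (d' & Hd' & H').
assert (Hm : (0 < Rmin d d')%R) by now apply Rmin_pos.
exists (mkposreal _ Hm); simpl; intros h Hh Hhd.
pose proof (Rmin_l d d'); pose proof (Rmin_r d d').
assert (E : RtoC (t + h) - RtoC t = RtoC h) by (rewrite RtoC_plus; ring).
specialize (H' (RtoC (t + h))); specialize (HH (RtoC (t + h))).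
rewrite E, Cmod_R in *.
rewrite HH by lra.
rewrite re_plus, re_scal_r.
replace ((Re (H t) + Re (phi (t + h)%R) * h - Re (H t)) / h)%R
  with (Re (phi (t + h)%R)) by (field; exact Hh).
rewrite <- Hl.
change (Re (phi (t + h)%R) - Re (phi t))%R with (Re (phi (t + h)%R - phi t)).
apply Rle_lt_trans with (1 := re_le_Cmod _), H'; lra.
Qed.

(** The imaginary part of [l] is the real part of [- Ci * l]. *)
Lemma cderiv_Im_derive (H : C -> C) (t : R) (l : C) :
  cderiv H t l -> is_derive (fun t : R => Im (H t)) t (Im l).
Proof.
intros HH.
pose proof (cderiv_Re_derive _ t _ (cderiv_scal (- Ci) _ _ _ HH)) as HR.
replace (Im l) with (Re (- Ci * l)) by (unfold Re, Im; simpl; ring).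
apply is_derive_ext with (2 := HR).
intros u; unfold Re, Im; simpl; ring.
Qed.

Lemma CInt_FTC (H h : C -> C) (a b : R) :
  gcont h -> (forall t : R, cderiv H t (h t)) -> CInt h a b = H b - H a.
Proof.
intros Hh HH; unfold CInt.
rewrite (surjective_pairing (H b - H a)); f_equal;
  apply (@is_RInt_unique R_CompleteNormedModule).
- apply (@is_RInt_derive R_CompleteNormedModule (fun t : R => Re (H t))); intros t _.
  + now apply cderiv_Re_derive.
  + now apply gcont_Re.
- apply (@is_RInt_derive R_CompleteNormedModule (fun t : R => Im (H t))); intros t _.
  + now apply cderiv_Im_derive.
  + now apply gcont_Im.
Qed.

(** * Contour integrals over rectangles and Goursat's theorem *)

Definition rect_int (F : C -> C) (a b c d : R) : C :=
  CInt (fun z => F (z + Ci * c)) a b - CInt (fun z => F (z + Ci * d)) a b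
  + Ci * (CInt (fun z => F (b + Ci * z)) c d - CInt (fun z => F (a + Ci * z)) c d).

Lemma gcont_comp (F g : C -> C) : gcont F -> gcont g -> gcont (fun z => F (g z)).
Proof. intros HF Hg z; now apply ccont_comp. Qed.

Lemma gcont_horizontal (F : C -> C) (k : C) : gcont F -> gcont (fun z => F (z + k)).
Proof.
intros HF; apply gcont_comp; [exact HF|]; intros z.
apply ccont_plus; [apply ccont_id|apply ccont_const].
Qed.

Lemma gcont_vertical (F : C -> C) (k : C) : gcont F -> gcont (fun z => F (k + Ci * z)).
Proof.
intros HF; apply gcont_comp; [exact HF|]; intros z.
apply ccont_plus; [apply ccont_const|]; apply ccont_mult; [apply ccont_const|apply ccont_id].
Qed.

Lemma rect_int_split_x (F : C -> C) (a m b c d : R) :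
  gcont F -> rect_int F a b c d = rect_int F a m c d + rect_int F m b c d.
Proof.
intros HF; unfold rect_int.
rewrite <- (CInt_Chasles (fun z => F (z + Ci * c)) a m b) by now apply gcont_horizontal.
rewrite <- (CInt_Chasles (fun z => F (z + Ci * d)) a m b) by now apply gcont_horizontal.
ring.
Qed.

Lemma rect_int_split_y (F : C -> C) (a b c n d : R) :
  gcont F -> rect_int F a b c d = rect_int F a b c n + rect_int F a b n d.
Proof.
intros HF; unfold rect_int.
rewrite <- (CInt_Chasles (fun z => F (b + Ci * z)) c n d) by now apply gcont_vertical.
rewrite <- (CInt_Chasles (fun z => F (a + Ci * z)) c n d) by now apply gcont_vertical.
ring.
Qed.

Lemma rect_int_plus (F G : C -> C) (a b c d : R) :
  gcont F -> gcont G ->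
  rect_int (fun z => F z + G z) a b c d = rect_int F a b c d + rect_int G a b c d.
Proof.
intros HF HG; unfold rect_int.
rewrite !(CInt_plus (fun z => F _) (fun z => G _))
  by first [now apply gcont_horizontal | now apply gcont_vertical].
ring.
Qed.

(** An affine function has the primitive [A * z + B * z ^ 2 / 2], whose increments along the four
    sides telescope. *)
Lemma rect_int_affine (A B : C) (a b c d : R) :
  rect_int (fun z => A + B * z) a b c d = 0.
Proof.
set (H := fun z => A * z + B * (z * z * / 2)).
assert (HH : forall z, cderiv H z (A + B * z)).
{ intros z; unfold H.
  replace (A + B * z) with (A * 1 + B * ((1 * z + z * 1) * / 2 + z * z * 0)) by field.
  apply cderiv_plus; apply cderiv_scal; [apply cderiv_id|].
  apply (cderiv_mult (fun z => z * z) (fun _ => / 2)); [|apply cderiv_const].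
  apply (cderiv_mult (fun z => z) (fun z => z)); apply cderiv_id. }
assert (HG : gcont (fun z => A + B * z)).
{ intros z; apply ccont_plus; [apply ccont_const|].
  apply ccont_mult; [apply ccont_const|apply ccont_id]. }
assert (E1 : forall k (a b : R), CInt (fun z => A + B * (z + k)) a b = H (b + k) - H (a + k)).
{ intros k a' b'.
  apply (CInt_FTC (fun z => H (z + k)) (fun z => A + B * (z + k))).
  - now apply (gcont_horizontal _ k HG).
  - intros t.
    replace (A + B * (t + k)) with ((A + B * (t + k)) * (1 + 0)) by ring.
    apply (cderiv_comp (fun z => z + k) H); [|apply HH].
    apply cderiv_plus; [apply cderiv_id|apply cderiv_const]. }
assert (E2 : forall k (a b : R),
  CInt (fun z => Ci * (A + B * (k + Ci * z))) a b = H (k + Ci * b) - H (k + Ci * a)).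
{ intros k a' b'.
  apply (CInt_FTC (fun z => H (k + Ci * z)) (fun z => Ci * (A + B * (k + Ci * z)))).
  - intros z; apply ccont_mult; [apply ccont_const|apply (gcont_vertical _ k HG)].
  - intros t.
    replace (Ci * (A + B * (k + Ci * t))) with ((A + B * (k + Ci * t)) * (0 + Ci * 1)) by ring.
    apply (cderiv_comp (fun z => k + Ci * z) H); [|apply HH].
    apply cderiv_plus; [apply cderiv_const|apply cderiv_scal, cderiv_id]. }
assert (Hd : forall u v, Ci * (u - v) = Ci * u - Ci * v) by (intros; ring).
unfold rect_int; rewrite !E1, Hd.
rewrite <- !CInt_scal by apply (gcont_vertical _ _ HG); rewrite !E2; ring.
Qed.

(** The constant 4 is the 2 of the perimeter times the 2 lost in [CInt_bound]. *)
Lemma rect_int_bound (F : C -> C) (a b c d M : R) :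
  gcont F -> (a <= b)%R -> (c <= d)%R ->
  (forall x y : R, (a <= x <= b)%R -> (c <= y <= d)%R -> (Cmod (F (x, y)) <= M)%R) ->
  (Cmod (rect_int F a b c d) <= 4 * ((b - a) + (d - c)) * M)%R.
Proof.
intros HF Hab Hcd HM; unfold rect_int.
assert (E : forall x y : R, x + Ci * y = (x, y)).
{ intros x y; apply injective_projections; simpl; ring. }
assert (H1 : forall y : R, (c <= y <= d)%R ->
  (Cmod (CInt (fun z => F (z + Ci * y)%C) a b) <= 2 * ((b - a) * M))%R).
{ intros y Hy; apply CInt_const_bound; auto using gcont_horizontal.
  intros t Ht; rewrite E; now apply HM. }
assert (H2 : forall x : R, (a <= x <= b)%R ->
  (Cmod (CInt (fun z => F (x + Ci * z)%C) c d) <= 2 * ((d - c) * M))%R).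
{ intros x Hx; apply CInt_const_bound; auto using gcont_vertical.
  intros t Ht; rewrite E; now apply HM. }
apply Rle_trans with (1 := Cmod_triangle _ _).
rewrite Cmod_mult, Cmod_Ci, Rmult_1_l.
pose proof (H1 c ltac:(lra)); pose proof (H1 d ltac:(lra)).
pose proof (H2 a ltac:(lra)); pose proof (H2 b ltac:(lra)).
assert (T : forall u v, (Cmod (u - v) <= Cmod u + Cmod v)%R).
{ intros u v; rewrite <- (Cmod_opp v); apply Cmod_triangle. }
pose proof (T (CInt (fun z => F (z + Ci * c)) a b) (CInt (fun z => F (z + Ci * d)) a b)).
pose proof (T (CInt (fun z => F (b + Ci * z)) c d) (CInt (fun z => F (a + Ci * z)) c d)).
lra.
Qed.

(** Pigeonhole on the four quarters, whose integrals add up to the whole. The corner is returned in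
    a sigma type so that the step can be iterated by recursion. *)
Lemma rect_int_bisect (F : C -> C) (x y w h M : R) :
  gcont F -> (0 <= w)%R -> (0 <= h)%R -> (4 * M < Cmod (rect_int F x (x + w) y (y + h)))%R ->
  {p : R * R | (x <= fst p <= x + w / 2)%R /\ (y <= snd p <= y + h / 2)%R /\
    (M < Cmod (rect_int F (fst p) (fst p + w / 2) (snd p) (snd p + h / 2)))%R}.
Proof.
intros HF Hw Hh HM.
rewrite (rect_int_split_x F x (x + w / 2) (x + w)) in HM by exact HF.
rewrite (rect_int_split_y F x (x + w / 2) y (y + h / 2)) in HM by exact HF.
rewrite (rect_int_split_y F (x + w / 2) (x + w) y (y + h / 2)) in HM by exact HF.
assert (Ex : (x + w = x + w / 2 + w / 2)%R) by field.
assert (Ey : (y + h = y + h / 2 + h / 2)%R) by field.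
rewrite Ex, Ey in HM.
set (J1 := rect_int F x (x + w / 2) y (y + h / 2)) in *.
set (J2 := rect_int F x (x + w / 2) (y + h / 2) (y + h / 2 + h / 2)) in *.
set (J3 := rect_int F (x + w / 2) (x + w / 2 + w / 2) y (y + h / 2)) in *.
set (J4 := rect_int F (x + w / 2) (x + w / 2 + w / 2) (y + h / 2) (y + h / 2 + h / 2)) in *.
pose proof (Cmod_triangle (J1 + J2) (J3 + J4)).
pose proof (Cmod_triangle J1 J2); pose proof (Cmod_triangle J3 J4).
destruct (Rlt_le_dec M (Cmod J1)); [exists (x, y); simpl; repeat split; first [assumption|lra]|].
destruct (Rlt_le_dec M (Cmod J2)); [exists (x, (y + h / 2)%R); simpl; repeat split; first [assumption|lra]|].
destruct (Rlt_le_dec M (Cmod J3)); [exists ((x + w / 2)%R, y); simpl; repeat split; first [assumption|lra]|].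
destruct (Rlt_le_dec M (Cmod J4)); [exists ((x + w / 2)%R, (y + h / 2)%R); simpl; repeat split; first [assumption|lra]|].
exfalso; lra.
Qed.

Lemma nested_intervals (p q : nat -> R) :
  (forall n, p n <= p (S n) /\ q (S n) <= q n /\ p n <= q n)%R ->
  exists x : R, forall n, (p n <= x <= q n)%R.
Proof.
intros H.
assert (Hp : forall n k, (p n <= p (k + n)%nat)%R).
{ intros n; induction k; [apply Rle_refl|].
  apply Rle_trans with (1 := IHk), H. }
assert (Hq : forall n k, (q (k + n)%nat <= q n)%R).
{ intros n; induction k; [apply Rle_refl|].
  apply Rle_trans with (2 := IHk), H. }
assert (Hpq : forall n m, (p n <= q m)%R).
{ intros n m.
  apply Rle_trans with (1 := Hp n m).
  apply Rle_trans with (2 := Hq m n).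
  rewrite Nat.add_comm; apply H. }
destruct (completeness (fun x => exists n, x = p n)) as [x [Hx1 Hx2]].
- exists (q 0%nat); intros x [n ->]; apply Hpq.
- now exists (p 0%nat), 0%nat.
- exists x; intros n; split; [apply Hx1; now exists n|].
  apply Hx2; intros y [m ->]; apply Hpq.
Qed.

(** The bisection proof is taken because [analytic_on] gives complex differentiability only, with no
    continuity of the derivative. *)
Lemma goursat (F : C -> C) (a b c d : R) :
  gcont F -> (a <= b)%R -> (c <= d)%R ->
  (forall x y : R, (a <= x <= b)%R -> (c <= y <= d)%R -> exists l, cderiv F (x, y) l) ->
  rect_int F a b c d = 0.
Proof.
intros HF Hab Hcd HD.
set (w := (b - a)%R); set (h := (d - c)%R).
set (m := Cmod (rect_int F a b c d)).
destruct (Rle_lt_dec m 0) as [Hm|Hm].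
{ apply Cmod_eq_0, Rle_antisym; [exact Hm|apply Cmod_ge_0]. }
exfalso.
set (s := fun n => ((1 / 2) ^ n)%R).
assert (Hs : forall n, (0 < s n)%R) by (intros n; apply pow_lt; lra).
assert (Hs' : forall n, (s (S n) = s n / 2)%R) by (intros n; unfold s; simpl; field).
(* The threshold has [m / 2] in place of [m] so that the inequality is strict already for [n = 0];
   each bisection then divides it by 4. *)
set (bad := fun n (p : R * R) =>
  (m / 2 * (s n * s n) < Cmod (rect_int F (fst p) (fst p + w * s n) (snd p) (snd p + h * s n)))%R).
assert (step : forall n p, bad n p -> {p' | bad (S n) p' /\
  (fst p <= fst p' <= fst p + w * s n / 2)%R /\ (snd p <= snd p' <= snd p + h * s n / 2)%R}).
{ intros n p Hp; unfold bad in *; rewrite Hs'.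
  pose proof (Hs n).
  destruct (rect_int_bisect F (fst p) (snd p) (w * s n) (h * s n)
    (m / 2 * (s n / 2 * (s n / 2)))%R) as (p' & H1 & H2 & H3); auto.
  1,2: unfold w, h; apply Rmult_le_pos; lra.
  { apply Rle_lt_trans with (2 := Hp), Req_le; field. }
  exists p'; split; [|split; assumption].
  unfold Rdiv in *; rewrite <- !Rmult_assoc; rewrite <- !Rmult_assoc in H3; exact H3. }
assert (bad0 : bad 0%nat (a, c)).
{ unfold bad, s, w, h; simpl.
  rewrite !Rmult_1_r.
  replace (a + (b - a))%R with b by ring; replace (c + (d - c))%R with d by ring.
  fold m; lra. }
set (u := fix u n : {p | bad n p} :=
  match n with
  | O => exist _ (a, c) bad0
  | S k => let (p, Hp) := u k in
           exist _ (proj1_sig (step k p Hp)) (proj1 (proj2_sig (step k p Hp)))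
  end).
set (x := fun n => fst (proj1_sig (u n))); set (y := fun n => snd (proj1_sig (u n))).
assert (Hstep : forall n, (x n <= x (S n) <= x n + w * s n / 2)%R /\
  (y n <= y (S n) <= y n + h * s n / 2)%R).
{ intros n; unfold x, y; simpl; destruct (u n) as [p Hp]; simpl.
  exact (proj2 (proj2_sig (step n p Hp))). }
assert (Hbad : forall n, bad n (x n, y n)).
{ intros n; unfold x, y; rewrite <- surjective_pairing; exact (proj2_sig (u n)). }
assert (Hw : (0 <= w)%R) by (unfold w; lra).
assert (Hh : (0 <= h)%R) by (unfold h; lra).
destruct (nested_intervals x (fun n => x n + w * s n)%R) as [x0 Hx0].
{ intros n; destruct (Hstep n) as [H1 _]; rewrite Hs'; pose proof (Hs n); repeat split; nra. }
destruct (nested_intervals y (fun n => y n + h * s n)%R) as [y0 Hy0].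
{ intros n; destruct (Hstep n) as [_ H1]; rewrite Hs'; pose proof (Hs n); repeat split; nra. }
destruct (HD x0 y0) as [l (phi & Hc & Hl & e & He & HFe)].
{ pose proof (Hx0 0%nat) as H; unfold x, s, w in H; simpl in H; lra. }
{ pose proof (Hy0 0%nat) as H; unfold y, s, h in H; simpl in H; lra. }
set (D := (w + h)%R).
assert (HD0 : (0 <= D)%R) by (unfold D; lra).
(* On the n-th rectangle the remainder of [F] after its affine part is at most [eps * (D * s n)], so
   its integral is at most [4 * D ^ 2 * eps * s n ^ 2]; this [eps] keeps that below
   [m / 2 * s n ^ 2]. The added 1 covers [D = 0]. *)
set (eps := (m / (8 * D ^ 2 + 1))%R).
assert (Heps : (0 < eps)%R) by (apply Rdiv_lt_0_compat; [exact Hm|nra]).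
destruct (Hc eps Heps) as (e' & He' & Hphi).
set (del := Rmin e e').
assert (Hdel : (0 < del)%R) by now apply Rmin_pos.
destruct (pow_lt_1_zero (1 / 2) ltac:(rewrite Rabs_pos_eq; lra) (del / (D + 1))%R
  ltac:(apply Rdiv_lt_0_compat; lra)) as [n Hn].
specialize (Hn n (le_n n)); fold (s n) in Hn.
pose proof (Hs n) as Hsn.
rewrite Rabs_pos_eq in Hn by lra.
assert (Hsmall : (D * s n < del)%R).
{ apply (Rmult_lt_compat_r (D + 1)) in Hn; [|lra].
  unfold Rdiv in Hn; rewrite Rmult_assoc, Rinv_l in Hn by lra; nra. }
set (z0 := (x0, y0) : C).
(* Subtracting the tangent map at the common point [z0] does not change the integral, by
   [rect_int_affine]. *)
set (E := fun z => F z - (F z0 - l * z0 + l * z)).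
assert (HA : gcont (fun z => F z0 - l * z0 + l * z)).
{ intros z; apply ccont_plus; [apply ccont_const|].
  apply ccont_mult; [apply ccont_const|apply ccont_id]. }
assert (HE : gcont E) by (intros z; apply ccont_minus; [apply HF|apply HA]).
specialize (Hbad n); unfold bad in Hbad; simpl in Hbad.
specialize (Hx0 n); specialize (Hy0 n).
set (J := rect_int F _ _ _ _) in Hbad.
assert (HJ : J = rect_int E (x n) (x n + w * s n) (y n) (y n + h * s n)).
{ transitivity (rect_int (fun z => E z + (F z0 - l * z0 + l * z))
    (x n) (x n + w * s n) (y n) (y n + h * s n)).
  - unfold J, rect_int; f_equal; [f_equal|f_equal; f_equal]; apply CInt_ext;
      intros; unfold E; ring.
  - rewrite (rect_int_plus E _ _ _ _ _ HE HA), rect_int_affine; ring. }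
pose proof (rect_int_bound E (x n) (x n + w * s n) (y n) (y n + h * s n) (eps * (D * s n)) HE) as HB.
rewrite <- HJ in HB.
apply Rlt_not_le in Hbad; apply Hbad.
apply Rle_trans with (1 := HB ltac:(nra) ltac:(nra) ltac:(
  intros x1 y1 Hx1 Hy1;
  assert (Hd : (Cmod ((x1, y1) - z0) <= D * s n)%R) by
   (apply Rle_trans with (1 := Cmod_le_Re_Im _); unfold z0, Re, Im; simpl;
    unfold D; rewrite Rmult_plus_distr_r; apply Rplus_le_compat; apply Rabs_le; lra);
  assert (Hde : (Cmod ((x1, y1) - z0) < del)%R) by lra;
  replace (E (x1, y1)) with ((phi (x1, y1) - phi z0) * ((x1, y1) - z0)) by
   (unfold E; rewrite (HFe (x1, y1) (Rlt_le_trans _ _ _ Hde (Rmin_l e e'))), <- Hl; fold z0; ring);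
  rewrite Cmod_mult;
  apply Rmult_le_compat;
   [apply Cmod_ge_0|apply Cmod_ge_0|exact (Rlt_le _ _ (Hphi _ (Rlt_le_trans _ _ _ Hde (Rmin_r e e'))))|exact Hd])).
replace (4 * (x n + w * s n - x n + (y n + h * s n - y n)) * (eps * (D * s n)))%R
  with (eps * (4 * D ^ 2) * (s n * s n))%R by (unfold D; ring).
apply Rmult_le_compat_r; [nra|].
apply (Rmult_le_reg_r (8 * D ^ 2 + 1)); [nra|].
replace (eps * (4 * D ^ 2) * (8 * D ^ 2 + 1))%R with (m * (4 * D ^ 2))%R
  by (unfold eps; field; nra).
nra.
Qed.

(** * Mean values over circles *)

Definition cmean (f : C -> C) : C :=
  / (2 * PI)%R * CInt (fun z => f (Cexp (Ci * z))) 0 (2 * PI).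

Lemma two_PI_pos : (0 < 2 * PI)%R.
Proof. pose proof PI_RGT_0; lra. Qed.

Lemma two_PI_neq_0 : RtoC (2 * PI) <> 0.
Proof. intros H; apply RtoC_inj in H; pose proof two_PI_pos; lra. Qed.

Lemma gcont_Cexp_Ci (f : C -> C) : gcont f -> gcont (fun z => f (Cexp (Ci * z))).
Proof.
intros Hf; apply gcont_comp; [exact Hf|]; intros z.
apply ccont_Cexp, ccont_mult; [apply ccont_const|apply ccont_id].
Qed.

Lemma Cmod_Cexp_Ci (t : R) : Cmod (Cexp (Ci * t)) = 1%R.
Proof.
rewrite Cmod_Cexp; replace (Re (Ci * t)) with 0%R; [apply exp_0|].
unfold Re; simpl; ring.
Qed.

Lemma cmean_ext (f g : C -> C) :
  (forall w, Cmod w = 1%R -> f w = g w) -> cmean f = cmean g.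
Proof.
intros H; unfold cmean; f_equal; apply CInt_ext; intros t _.
apply H, Cmod_Cexp_Ci.
Qed.

Lemma cmean_plus (f g : C -> C) :
  gcont f -> gcont g -> cmean (fun w => f w + g w) = cmean f + cmean g.
Proof.
intros Hf Hg; unfold cmean.
rewrite (CInt_plus (fun z => f _) (fun z => g _)) by now apply gcont_Cexp_Ci.
ring.
Qed.

Lemma cmean_minus (f g : C -> C) :
  gcont f -> gcont g -> cmean (fun w => f w - g w) = cmean f - cmean g.
Proof.
intros Hf Hg; unfold cmean.
rewrite (CInt_minus (fun z => f _) (fun z => g _)) by now apply gcont_Cexp_Ci.
ring.
Qed.

Lemma cmean_scal (c : C) (f : C -> C) :
  gcont f -> cmean (fun w => c * f w) = c * cmean f.
Proof.
intros Hf; unfold cmean.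
rewrite (CInt_scal c (fun z => f _)) by now apply gcont_Cexp_Ci.
ring.
Qed.

Lemma cmean_const (c : C) : cmean (fun _ => c) = c.
Proof.
unfold cmean; rewrite CInt_const, Rminus_0_r.
rewrite Cmult_assoc, Cinv_l by apply two_PI_neq_0; ring.
Qed.

Lemma cmean_conj (f : C -> C) : gcont f -> cmean (fun w => Cconj (f w)) = Cconj (cmean f).
Proof.
intros Hf; unfold cmean.
rewrite (CInt_conj (fun z => f _)) by now apply gcont_Cexp_Ci.
rewrite Cmult_conj; f_equal.
pose proof two_PI_pos; rewrite <- RtoC_inv by lra.
apply injective_projections; simpl; ring.
Qed.

Lemma cmean_le (f g : C -> C) : gcont f -> gcont g ->
  (forall w, Cmod w = 1%R -> (Re (f w) <= Re (g w))%R) -> (Re (cmean f) <= Re (cmean g))%R.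
Proof.
intros Hf Hg H; pose proof two_PI_pos; unfold cmean.
rewrite <- RtoC_inv, !re_scal_l by lra.
apply Rmult_le_compat_l; [apply Rlt_le, Rinv_0_lt_compat; lra|].
apply CInt_le; [now apply gcont_Cexp_Ci|now apply gcont_Cexp_Ci|lra|].
intros t _; apply H, Cmod_Cexp_Ci.
Qed.

Lemma cmean_bound (f g : C -> C) : gcont f -> gcont g ->
  (forall w, Cmod w = 1%R -> (Cmod (f w) <= Re (g w))%R) ->
  (Cmod (cmean f) <= 2 * Re (cmean g))%R.
Proof.
intros Hf Hg H; pose proof two_PI_pos; unfold cmean.
assert (0 < / (2 * PI))%R by (apply Rinv_0_lt_compat; lra).
rewrite <- RtoC_inv, re_scal_l, Cmod_mult, Cmod_R, Rabs_pos_eq by lra.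
rewrite <- Rmult_assoc, (Rmult_comm 2 (/ _)), Rmult_assoc.
apply Rmult_le_compat_l; [lra|].
apply CInt_bound; [now apply gcont_Cexp_Ci|now apply gcont_Cexp_Ci|lra|].
intros t _; apply H, Cmod_Cexp_Ci.
Qed.

Lemma gcont_radius (f : C -> C) (r : R) : gcont f -> gcont (fun w => f (r * w)).
Proof.
intros Hf; apply gcont_comp; [exact Hf|]; intros z.
apply ccont_mult; [apply ccont_const|apply ccont_id].
Qed.

Lemma exp_le (x y : R) : (x <= y -> exp x <= exp y)%R.
Proof. intros [H| ->]; [now apply Rlt_le, exp_increasing|apply Rle_refl]. Qed.

(** Under [Cexp] the vertical sides of the rectangle from [ln r1] to [ln r2], of height [2 * PI],
    become the two circles, and the horizontal sides cancel by periodicity. Composing with [Cexp]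
    avoids any branch of the logarithm. *)
Lemma cmean_radius_const (f : C -> C) (r1 r2 : R) :
  gcont f -> (0 < r1 <= r2)%R ->
  (forall w, (r1 <= Cmod w <= r2)%R -> exists l, cderiv f w l) ->
  cmean (fun w => f (r1 * w)) = cmean (fun w => f (r2 * w)).
Proof.
intros Hf Hr HD.
set (F := fun z => f (Cexp z)).
assert (HF : gcont F).
{ apply (gcont_comp f Cexp); [exact Hf|]; intros z; apply (ccont_Cexp (fun z => z)), ccont_id. }
pose proof two_PI_pos as Hpi.
assert (Hln : (ln r1 <= ln r2)%R).
{ destruct (proj2 Hr) as [H| ->]; [apply Rlt_le, ln_increasing; lra|apply Rle_refl]. }
assert (HJ : rect_int F (ln r1) (ln r2) 0 (2 * PI) = 0).
{ apply goursat; [exact HF|exact Hln|lra|].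
  intros x y Hx _.
  destruct (HD (Cexp (x, y))) as [l Hl].
  { rewrite Cmod_Cexp; simpl.
    rewrite <- (exp_ln r1), <- (exp_ln r2) by lra.
    split; apply exp_le; lra. }
  exists (l * Cexp (x, y)); apply (cderiv_comp Cexp f); [apply cderiv_Cexp|exact Hl]. }
assert (E : forall r, (0 < r)%R -> CInt (fun z => F (ln r + Ci * z)) 0 (2 * PI)
   = CInt (fun z => f (r * Cexp (Ci * z))) 0 (2 * PI)).
{ intros r H; apply CInt_ext; intros t _; unfold F; rewrite Cexp_plus; do 2 f_equal.
  unfold Cexp; simpl; rewrite exp_ln, cos_0, sin_0 by lra.
  apply injective_projections; simpl; ring. }
unfold rect_int in HJ; rewrite !E in HJ by lra.
rewrite (CInt_ext (fun z => F (z + Ci * 0%R)) (fun z => F (z + Ci * (2 * PI)%R))) in HJ.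
2:{ intros t _; unfold F; rewrite !Cexp_plus; do 2 f_equal.
    unfold Cexp; simpl.
    replace (0 * 0 + 1 * (2 * PI))%R with (2 * PI)%R by ring.
    replace (0 * 0 + 1 * 0)%R with 0%R by ring.
    rewrite cos_2PI, sin_2PI, cos_0, sin_0.
    apply injective_projections; simpl; f_equal; f_equal; ring. }
unfold cmean; f_equal.
set (A := CInt (fun z => f (r2 * _)) _ _) in *.
set (B := CInt (fun z => f (r1 * _)) _ _) in *.
replace A with (B + - Ci * (Ci * (A - B))); [|].
2:{ replace (- Ci * (Ci * (A - B))) with (- (Ci * Ci) * (A - B)) by ring.
    replace (Ci * Ci) with (- (1) : C) by (apply injective_projections; simpl; ring); ring. }
replace (Ci * (A - B)) with (RtoC 0); [ring|].
rewrite <- HJ; ring.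
Qed.

(** * Mean values of functions holomorphic in the disc *)

Lemma polar_continuity_2d (f : C -> C) (t0 r0 eps : R) :
  gcont f -> (0 < eps)%R ->
  locally_2d (fun t r : R =>
    (Cmod (f (r * Cexp (Ci * t))%C - f (r0 * Cexp (Ci * t0))%C) < eps)%R) t0 r0.
Proof.
intros Hf He.
destruct (Hf (r0 * Cexp (Ci * t0)) eps He) as (d & Hd & H).
assert (HC : ccont (fun z => Cexp (Ci * z)) t0).
{ apply ccont_Cexp, ccont_mult; [apply ccont_const|apply ccont_id]. }
pose proof (Rabs_pos r0) as Hr0.
assert (Hq : (0 < d / (2 * (Rabs r0 + 1)))%R) by (apply Rdiv_lt_0_compat; lra).
destruct (HC _ Hq) as (d' & Hd' & H').
assert (Hm : (0 < Rmin (d / 2) d')%R) by (apply Rmin_pos; lra).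
exists (mkposreal _ Hm); simpl; intros t r Ht Hr.
pose proof (Rmin_l (d / 2) d'); pose proof (Rmin_r (d / 2) d').
apply H.
replace (r * Cexp (Ci * t) - r0 * Cexp (Ci * t0))
  with ((r - r0) * Cexp (Ci * t) + r0 * (Cexp (Ci * t) - Cexp (Ci * t0))) by ring.
apply Rle_lt_trans with (1 := Cmod_triangle _ _).
rewrite !Cmod_mult, Cmod_Cexp_Ci, <- RtoC_minus, !Cmod_R, Rmult_1_r.
specialize (H' (RtoC t)); rewrite <- RtoC_minus, Cmod_R in H'.
specialize (H' ltac:(lra)).
set (q := (d / (2 * (Rabs r0 + 1)))%R) in *.
assert (q * (Rabs r0 + 1) = d / 2)%R by (unfold q; field; lra).
assert (Rabs r0 * Cmod (Cexp (Ci * t) - Cexp (Ci * t0)) <= Rabs r0 * q)%R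
  by (apply Rmult_le_compat_l; lra).
lra.
Qed.

(** Compactness of the range of the angle makes continuity in the radius uniform, which is what
    passing to the limit under the mean requires. *)
Lemma polar_uniform (f : C -> C) (r0 eps : R) :
  gcont f -> (0 < eps)%R -> exists d : R, (0 < d)%R /\
    forall r t : R, (Rabs (r - r0) < d)%R -> (0 <= t <= 2 * PI)%R ->
      (Cmod (f (r * Cexp (Ci * t))%C - f (r0 * Cexp (Ci * t))%C) <= eps)%R.
Proof.
intros Hf He.
assert (He2 : (0 < eps / 2)%R) by lra.
destruct (uniform_continuity_2d_1d (fun t r => Re (f (r * Cexp (Ci * t)))) 0 (2 * PI) r0)
  with (eps := mkposreal _ He2) as [d1 H1].
{ intros t _ e; destruct (polar_continuity_2d f t r0 e Hf (cond_pos e)) as [d Hd].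
  exists d; intros u v Hu Hv.
  exact (Rle_lt_trans _ _ _ (re_le_Cmod _) (Hd u v Hu Hv)). }
destruct (uniform_continuity_2d_1d (fun t r => Im (f (r * Cexp (Ci * t)))) 0 (2 * PI) r0)
  with (eps := mkposreal _ He2) as [d2 H2].
{ intros t _ e; destruct (polar_continuity_2d f t r0 e Hf (cond_pos e)) as [d Hd].
  exists d; intros u v Hu Hv.
  exact (Rle_lt_trans _ _ _ (im_le_Cmod _) (Hd u v Hu Hv)). }
pose proof (cond_pos d1); pose proof (cond_pos d2).
exists (Rmin d1 d2); split; [now apply Rmin_pos|]; intros r t Hr Ht.
pose proof (Rmin_l d1 d2); pose proof (Rmin_r d1 d2).
apply Rabs_lt_between in Hr.
apply Rle_trans with (1 := Cmod_le_Re_Im _).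
assert (Ht0 : forall d : posreal, (Rabs (t - t) < d)%R).
{ intros d; rewrite Rminus_eq_0, Rabs_R0; apply cond_pos. }
specialize (H1 t r0 t r Ht ltac:(lra) Ht ltac:(lra) (Ht0 d1)).
specialize (H2 t r0 t r Ht ltac:(lra) Ht ltac:(lra) (Ht0 d2)).
simpl in H1, H2.
unfold Re, Im in *; simpl; unfold Rminus in *; lra.
Qed.

Lemma cmean_radius_continuous (f : C -> C) (r0 eps : R) :
  gcont f -> (0 < eps)%R -> exists d : R, (0 < d)%R /\
    forall r : R, (Rabs (r - r0) < d)%R ->
      (Cmod (cmean (fun w => f (r * w)%C) - cmean (fun w => f (r0 * w)%C)) <= eps)%R.
Proof.
intros Hf He.
destruct (polar_uniform f r0 (eps / 2) Hf) as (d & Hd & H); [lra|].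
exists d; split; [exact Hd|]; intros r Hr.
rewrite <- cmean_minus by now apply gcont_radius.
pose proof two_PI_pos as Hpi.
set (g := fun w => f (r * w) - f (r0 * w)).
assert (Hg : gcont g).
{ intros z; apply ccont_minus; now apply gcont_radius. }
assert (HI : (Cmod (CInt (fun z => g (Cexp (Ci * z)%C)) 0 (2 * PI))
  <= 2 * ((2 * PI - 0) * (eps / 2)))%R).
{ apply CInt_const_bound; [now apply gcont_Cexp_Ci|lra|].
  intros t Ht; now apply H. }
unfold cmean.
rewrite Cmod_mult, <- RtoC_inv, Cmod_R, Rabs_pos_eq
  by (try apply Rlt_le, Rinv_0_lt_compat; lra).
apply (Rmult_le_reg_l (2 * PI)); [lra|].
rewrite <- Rmult_assoc, Rinv_r, Rmult_1_l by lra.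
lra.
Qed.

(** Differentiability is available only strictly between the two circles, so the annulus is shrunk
    by [t] on both sides and continuity of the mean in the radius closes the gap. The case [r1 = 0]
    yields the value at the centre. *)
Lemma cmean_annulus (f : C -> C) (r1 r2 : R) :
  gcont f -> (0 <= r1 < r2)%R ->
  (forall w, (r1 < Cmod w < r2)%R -> exists l, cderiv f w l) ->
  cmean (fun w => f (r1 * w)) = cmean (fun w => f (r2 * w)).
Proof.
intros Hf Hr HD.
set (M := fun r : R => cmean (fun w => f (r * w))).
change (M r1 = M r2).
apply Ceq_minus, Cmod_eq_0, Rle_antisym; [|apply Cmod_ge_0].
apply le_epsilon; intros eps He; rewrite Rplus_0_l.
destruct (cmean_radius_continuous f r1 (eps / 2) Hf) as (d1 & Hd1 & H1); [lra|].
destruct (cmean_radius_continuous f r2 (eps / 2) Hf) as (d2 & Hd2 & H2); [lra|].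
set (t := (Rmin (Rmin d1 d2) (r2 - r1) / 4)%R).
assert (Ht : (0 < t)%R).
{ unfold t; apply Rdiv_lt_0_compat; [|lra]; repeat apply Rmin_pos; lra. }
assert (Ht1 : (4 * t <= d1 /\ 4 * t <= d2 /\ 4 * t <= r2 - r1)%R).
{ unfold t; pose proof (Rmin_l (Rmin d1 d2) (r2 - r1)).
  pose proof (Rmin_r (Rmin d1 d2) (r2 - r1)).
  pose proof (Rmin_l d1 d2); pose proof (Rmin_r d1 d2); lra. }
assert (E : M (r1 + t)%R = M (r2 - t)%R).
{ apply cmean_radius_const; [exact Hf|lra|].
  intros w Hw; apply HD; lra. }
specialize (H1 (r1 + t)%R ltac:(rewrite Rabs_pos_eq; lra)).
specialize (H2 (r2 - t)%R ltac:(rewrite Rabs_left1; lra)).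
fold (M (r1 + t)%R) (M r1) in H1; fold (M (r2 - t)%R) (M r2) in H2.
rewrite E in H1.
replace (M r1 - M r2) with ((M (r2 - t)%R - M r2) + - (M (r2 - t)%R - M r1)) by ring.
apply Rle_trans with (1 := Cmod_triangle _ _); rewrite Cmod_opp; lra.
Qed.

(** The exceptional circle of radius [rho] lets the mean value property be
    applied to difference quotients. *)
Lemma cmean_disc (f : C -> C) (rho : R) :
  gcont f -> (0 <= rho < 1)%R ->
  (forall w, (0 < Cmod w < 1)%R -> Cmod w <> rho -> exists l, cderiv f w l) ->
  cmean f = f 0.
Proof.
intros Hf Hr HD.
transitivity (cmean (fun w => f (1%R * w))).
{ apply cmean_ext; intros; f_equal; ring. }
transitivity (cmean (fun w => f (0%R * w))).
2:{ rewrite <- (cmean_const (f 0)); apply cmean_ext; intros; f_equal; ring. }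
symmetry.
destruct (Req_dec rho 0) as [->|H0].
- apply cmean_annulus; [exact Hf|lra|].
  intros w Hw; apply HD; lra.
- transitivity (cmean (fun w => f (rho * w))); apply cmean_annulus; try exact Hf; try lra;
    intros w Hw; apply HD; lra.
Qed.

(** Representative, continuous on the whole plane, of a function which is
    continuous on the closed unit disc and holomorphic on the punctured open
    disc. *)
Definition disc_fun (f : C -> C) : Prop :=
  gcont f /\ forall w, (0 < Cmod w < 1)%R -> exists l, cderiv f w l.

Lemma disc_fun_mean (f : C -> C) : disc_fun f -> cmean f = f 0.
Proof. intros [Hf HD]; apply (cmean_disc f 0); auto; lra. Qed.

Lemma disc_fun_entire (f df : C -> C) : (forall z, cderiv f z (df z)) -> disc_fun f.
Proof.
intros H; split; [intros z; now apply cderiv_ccont with (df z)|].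
intros w _; now exists (df w).
Qed.

Lemma disc_fun_const (c : C) : disc_fun (fun _ => c).
Proof. apply disc_fun_entire with (fun _ => 0); apply cderiv_const. Qed.

Lemma disc_fun_id : disc_fun (fun w => w).
Proof. apply disc_fun_entire with (fun _ => 1); apply cderiv_id. Qed.

Lemma disc_fun_plus (f g : C -> C) : disc_fun f -> disc_fun g -> disc_fun (fun w => f w + g w).
Proof.
intros [Hf Hf'] [Hg Hg']; split; [intros z; now apply ccont_plus|].
intros w Hw; destruct (Hf' w Hw) as [l Hl], (Hg' w Hw) as [m Hm].
exists (l + m); now apply cderiv_plus.
Qed.

Lemma disc_fun_mult (f g : C -> C) : disc_fun f -> disc_fun g -> disc_fun (fun w => f w * g w).
Proof.
intros [Hf Hf'] [Hg Hg']; split; [intros z; now apply ccont_mult|].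
intros w Hw; destruct (Hf' w Hw) as [l Hl], (Hg' w Hw) as [m Hm].
exists (l * g w + f w * m); now apply cderiv_mult.
Qed.

Lemma disc_fun_minus (f g : C -> C) : disc_fun f -> disc_fun g -> disc_fun (fun w => f w - g w).
Proof.
intros [Hf Hf'] [Hg Hg']; split; [intros z; now apply ccont_minus|].
intros w Hw; destruct (Hf' w Hw) as [l Hl], (Hg' w Hw) as [m Hm].
exists (l - m); now apply cderiv_minus.
Qed.

Lemma cderiv_Cexp_scal (k z : C) : cderiv (fun w => Cexp (k * w)) z (k * Cexp (k * z)).
Proof.
replace (k * Cexp (k * z)) with (Cexp (k * z) * (k * 1)) by ring.
apply (cderiv_comp (fun w => k * w) Cexp); [apply cderiv_scal, cderiv_id|apply cderiv_Cexp].
Qed.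

Lemma disc_fun_exp (k : C) : disc_fun (fun w => Cexp (k * w)).
Proof. apply disc_fun_entire with (fun z => k * Cexp (k * z)), cderiv_Cexp_scal. Qed.

Lemma gcont_conj : gcont Cconj.
Proof. intros z; apply (ccont_conj (fun z => z)), ccont_id. Qed.

Lemma gcont_conj_mult (f : C -> C) : gcont f -> gcont (fun w => Cconj w * f w).
Proof. intros Hf z; apply ccont_mult; [apply gcont_conj|apply Hf]. Qed.

Lemma cmean_conj_id : cmean Cconj = 0.
Proof.
transitivity (cmean (fun w => Cconj w)); [reflexivity|].
rewrite (cmean_conj (fun w => w)) by (intros z; apply ccont_id).
rewrite (disc_fun_mean _ disc_fun_id).
apply injective_projections; simpl; ring.
Qed.

Lemma cderiv_quadratic (f : C -> C) (l : C) (K d : R) :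
  (0 < d)%R -> (forall w, (Cmod w < d)%R -> (Cmod (f w - f 0 - l * w) <= K * Cmod w ^ 2)%R) ->
  cderiv f 0 l.
Proof.
intros Hd HK.
set (phi := fun w => if Ceq_dec w 0 then l else (f w - f 0) / w).
assert (Hphi : phi 0 = l) by (unfold phi; destruct (Ceq_dec 0 0); congruence).
exists phi; split; [|split; [exact Hphi|]].
- intros eps He.
  exists (Rmin d (eps / (Rabs K + 1))); pose proof (Rabs_pos K).
  split; [apply Rmin_pos; [exact Hd|apply Rdiv_lt_0_compat; lra]|].
  intros w Hw; rewrite Hphi.
  replace (w - 0) with w in Hw by ring.
  unfold phi; destruct (Ceq_dec w 0) as [->|Hw0]; [now apply Cmod_minus_self|].
  replace ((f w - f 0) / w - l) with ((f w - f 0 - l * w) * / w) by now field.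
  pose proof (proj1 (Cmod_gt_0 w) Hw0) as Hp.
  rewrite Cmod_mult, Cmod_inv by assumption.
  apply (Rmult_lt_reg_r (Cmod w)); [assumption|].
  rewrite Rmult_assoc, Rinv_l, Rmult_1_r by lra.
  pose proof (Rmin_l d (eps / (Rabs K + 1))); pose proof (Rmin_r d (eps / (Rabs K + 1))).
  apply Rle_lt_trans with (1 := HK w ltac:(lra)).
  assert (Hq : (Cmod w * (Rabs K + 1) < eps)%R).
  { apply Rlt_le_trans with (eps / (Rabs K + 1) * (Rabs K + 1))%R.
    - apply Rmult_lt_compat_r; lra.
    - apply Req_le; field; lra. }
  pose proof (Rle_abs K); nra.
- exists 1%R; split; [lra|]; intros w _.
  unfold phi; destruct (Ceq_dec w 0) as [->|Hw0]; [ring|].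
  replace (w - 0) with w by ring; field; exact Hw0.
Qed.

(** Removable singularity: [w0] being fixed, [k w = (f w - f w0) / (w - w0)]
    is continuous, so [w * k w] has mean value 0; on the unit circle
    [w * k w = (f w - f w0) * (1 + w0 * Cconj w) + w0 ^ 2 * Cconj w * k w]. *)
Lemma disc_fun_derive_0 (f : C -> C) :
  disc_fun f -> cderiv f 0 (cmean (fun w => Cconj w * f w)).
Proof.
intros Hdf; pose proof Hdf as [Hf HD].
set (l := cmean _).
set (S := Re (cmean (fun w => RtoC (Cmod (f w))))).
(* Near 0 this bounds |f w0| by |f 0| + 1, so that the constant in the quadratic estimate does not
   depend on [w0]. *)
destruct (Hf 0 1%R ltac:(lra)) as (d & Hd & H1).
apply cderiv_quadratic with (K := (4 * (S + (Cmod (f 0) + 1)))%R) (d := Rmin d (1 / 2)).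
{ apply Rmin_pos; lra. }
intros w0 Hw0.
destruct (Ceq_dec w0 0) as [->|Hn].
{ replace (f 0 - f 0 - l * 0) with (RtoC 0) by ring; rewrite Cmod_0; lra. }
pose proof (Rmin_l d (1 / 2)); pose proof (Rmin_r d (1 / 2)).
pose proof (proj1 (Cmod_gt_0 w0) Hn) as Hp.
destruct (HD w0 ltac:(lra)) as [m (phi & Hc & Hm & e & He & Hphi)].
set (k := fun w => if Ceq_dec w w0 then m else (f w - f w0) / (w - w0)).
assert (Hk : forall w, k w * (w - w0) = f w - f w0).
{ intros w; unfold k; destruct (Ceq_dec w w0) as [->|Hw]; [ring|].
  field; now apply Cminus_eq_contra. }
assert (Hko : forall w, w <> w0 -> exists r, (0 < r)%R /\
  forall v, (Cmod (v - w) < r)%R -> (f v - f w0) * / (v - w0) = k v).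
{ intros w Hw; apply Cminus_eq_contra, Cmod_gt_0 in Hw.
  exists (Cmod (w - w0)); split; [exact Hw|]; intros v Hv.
  unfold k; destruct (Ceq_dec v w0) as [->|Hv']; [|reflexivity].
  replace (w0 - w) with (- (w - w0)) in Hv by ring; rewrite Cmod_opp in Hv; lra. }
assert (Hkc : gcont k).
{ intros w; destruct (Ceq_dec w w0) as [->|Hw].
  - apply (ccont_local phi k w0 e He); [|exact Hc].
    intros w Hw; unfold k; destruct (Ceq_dec w w0) as [->|Hw']; [exact Hm|].
    rewrite (Hphi w Hw); field; now apply Cminus_eq_contra.
  - destruct (Hko w Hw) as (r & Hr & Hkr).
    apply (ccont_local (fun v => (f v - f w0) * / (v - w0)) k w r Hr Hkr).
    apply ccont_mult.
    + apply ccont_minus; [apply Hf|apply ccont_const].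
    + apply ccont_inv; [|now apply Cminus_eq_contra].
      apply ccont_minus; [apply ccont_id|apply ccont_const]. }
assert (Hmean : cmean (fun w => w * k w) = 0).
{ rewrite (cmean_disc (fun w => w * k w) (Cmod w0)); [ring| |lra|].
  - intros z; apply ccont_mult; [apply ccont_id|apply Hkc].
  - intros w Hw Hww.
    assert (Hne : w <> w0) by (intros ->; now apply Hww).
    destruct (HD w Hw) as [m' Hm'].
    destruct (Hko w Hne) as (r & Hr & Hkr).
    assert (Hdk : exists n, cderiv k w n).
    { eexists; apply (cderiv_local (fun v => (f v - f w0) * / (v - w0)) k w _ r Hr Hkr).
      apply cderiv_mult.
      - apply cderiv_minus; [exact Hm'|apply cderiv_const].
      - apply (cderiv_comp (fun v => v - w0) Cinv).
        + apply cderiv_minus; [apply cderiv_id|apply cderiv_const].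
        + apply cderiv_inv; now apply Cminus_eq_contra. }
    destruct Hdk as [n Hdk].
    exists (1 * k w + w * n); apply (cderiv_mult (fun v => v) k); [apply cderiv_id|exact Hdk]. }
assert (Hcw : forall w, Cmod w = 1%R -> w * Cconj w = 1).
{ intros w Hw; rewrite <- Cmod2_conj, Hw; apply injective_projections; simpl; ring. }
set (A := fun w => (f w - f w0) + (w0 * (Cconj w * f w) - w0 * f w0 * Cconj w)).
assert (Hl : gcont (fun w => Cconj w * f w)) by now apply gcont_conj_mult.
assert (Hck : gcont (fun w => Cconj w * k w)) by now apply gcont_conj_mult.
assert (Hs : forall c g, gcont g -> gcont (fun w => c * g w)).
{ intros c g Hg z; apply ccont_mult; [apply ccont_const|apply Hg]. }
assert (HA1 : gcont (fun w => f w - f w0)).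
{ intros z; apply ccont_minus; [apply Hf|apply ccont_const]. }
assert (HA2 : gcont (fun w => w0 * (Cconj w * f w) - w0 * f w0 * Cconj w)).
{ intros z; apply ccont_minus; apply Hs; [exact Hl|exact gcont_conj]. }
assert (EA : cmean A = f 0 - f w0 + w0 * l).
{ unfold A; rewrite cmean_plus, !cmean_minus, !cmean_scal, cmean_conj_id, cmean_const;
    auto using gcont_conj.
  - rewrite (disc_fun_mean f Hdf); fold l; ring.
  - intros z; apply ccont_const. }
assert (Emain : f w0 - f 0 - l * w0 = w0 * w0 * cmean (fun w => Cconj w * k w)).
{ rewrite (cmean_ext _ (fun w => A w + w0 * w0 * (Cconj w * k w))) in Hmean.
  - rewrite cmean_plus, cmean_scal, EA in Hmean; auto.
    + replace (f w0 - f 0 - l * w0) with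
        (w0 * w0 * cmean (fun w => Cconj w * k w) -
          (f 0 - f w0 + w0 * l + w0 * w0 * cmean (fun w => Cconj w * k w))) by ring.
      rewrite Hmean; ring.
    + intros z; now apply ccont_plus.
  - intros w Hw; unfold A.
    transitivity (k w * (w - w0) + w0 * (w * Cconj w) * k w); [rewrite (Hcw w Hw); ring|].
    rewrite Hk.
    transitivity (f w - f w0 + w0 * Cconj w * (k w * (w - w0)) + w0 * w0 * (Cconj w * k w));
      [ring|rewrite Hk; ring]. }
rewrite Emain, !Cmod_mult.
(* Since |w0| < 1/2, the distance from [w0] to the circle is at least 1/2, so |k w| <= 2 (|f w| + |f
   w0|) there; the other factor 2 is that of [cmean_bound]. *)
assert (HB : (Cmod (cmean (fun w => (Cconj w * k w)%C)) <= 2 * (2 * (S + (Cmod (f 0) + 1))))%R).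
{ set (B := fun w => 2 * (RtoC (Cmod (f w)) + RtoC (Cmod (f 0) + 1))).
  assert (HfC : gcont (fun w => RtoC (Cmod (f w)))) by (intros z; apply ccont_Cmod, Hf).
  assert (HfC' : gcont (fun w => RtoC (Cmod (f w)) + RtoC (Cmod (f 0) + 1))).
  { intros z; apply ccont_plus; [apply HfC|apply ccont_const]. }
  replace (2 * (S + (Cmod (f 0) + 1)))%R with (Re (cmean B)).
  - apply cmean_bound; [exact Hck|now apply Hs|].
    intros w Hw; rewrite Cmod_mult, Cmod_conj, Hw, Rmult_1_l.
    unfold B; rewrite <- RtoC_plus, <- RtoC_mult, re_RtoC.
    specialize (H1 w0 ltac:(replace (w0 - 0) with w0 by ring; lra)).
    pose proof (Cmod_reverse_triangle (f w0) (f 0)) as Hr1.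
    pose proof (Cmod_reverse_triangle w w0) as Hr2.
    apply Rabs_le_between in Hr1, Hr2.
    pose proof (Cmod_triangle (f w) (- f w0)) as Ht; rewrite Cmod_opp in Ht.
    change (f w + - f w0) with (f w - f w0) in Ht.
    rewrite <- (Hk w), Cmod_mult in Ht.
    pose proof (Cmod_ge_0 (k w)); nra.
  - unfold B; rewrite cmean_scal, cmean_plus, cmean_const; auto.
    + rewrite re_scal_l, re_plus, re_RtoC; reflexivity.
    + intros z; apply ccont_const. }
replace (Cmod w0 * Cmod w0)%R with (Cmod w0 ^ 2)%R by ring.
rewrite (Rmult_comm _ (Cmod w0 ^ 2)).
apply Rmult_le_compat_l; [apply pow2_ge_0|lra].
Qed.

Lemma cderiv_unique (f : C -> C) (z l m : C) : cderiv f z l -> cderiv f z m -> l = m.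
Proof.
intros (phi & Hc & Hl & d & Hd & H) (psi & Hc' & Hm & d' & Hd' & H').
apply Ceq_minus, Cmod_eq_0, Rle_antisym; [|apply Cmod_ge_0].
apply le_epsilon; intros eps He; rewrite Rplus_0_l.
destruct (ccont_minus _ _ _ Hc Hc' eps He) as (e & He' & HE).
set (t := (Rmin e (Rmin d d') / 2)%R).
assert (Ht : (0 < t /\ t < e /\ t < d /\ t < d')%R).
{ assert (0 < Rmin e (Rmin d d'))%R by (repeat apply Rmin_pos; assumption).
  pose proof (Rmin_l e (Rmin d d')); pose proof (Rmin_r e (Rmin d d')).
  pose proof (Rmin_l d d'); pose proof (Rmin_r d d'); unfold t; lra. }
assert (Hz : (Cmod (z + t - z) = t)%R).
{ replace (z + t - z) with (RtoC t) by ring; rewrite Cmod_R, Rabs_pos_eq; lra. }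
assert (E : phi (z + t) = psi (z + t)).
{ specialize (H (z + t) ltac:(lra)); rewrite (H' (z + t) ltac:(lra)) in H.
  assert (Ht0 : RtoC t <> 0) by (intros Hc0; apply RtoC_inj in Hc0; lra).
  transitivity (((f z + phi (z + t) * (z + t - z)) - f z) * / t); [now field|].
  rewrite <- H; now field. }
specialize (HE (z + t) ltac:(lra)).
rewrite E, Hl, Hm in HE.
replace (psi (z + t) - psi (z + t) - (l - m)) with (- (l - m)) in HE by ring.
rewrite Cmod_opp in HE; lra.
Qed.

Lemma Cmult_conj_circle (w : C) : Cmod w = 1%R -> w * Cconj w = 1.
Proof. intros Hw; rewrite <- Cmod2_conj, Hw; apply injective_projections; simpl; ring. Qed.

(** Integration by parts: the derivative of [exp (-2 i t) * exp (k * exp (i t))]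
    has integral 0 over a period. *)
Lemma cmean_conj2_exp (k : C) :
  cmean (fun w => Cconj w * (Cconj w * Cexp (k * w))) = k * k / 2.
Proof.
pose proof (disc_fun_exp k) as Hdf.
(* This mean is the derivative at 0 by [disc_fun_derive_0], and a derivative is unique. *)
assert (H1 : cmean (fun w => Cconj w * Cexp (k * w)) = k).
{ apply (cderiv_unique (fun w => Cexp (k * w)) 0); [now apply disc_fun_derive_0|].
  pose proof (cderiv_Cexp_scal k 0) as H0.
  now rewrite Cmult_0_r, Cexp_0, Cmult_1_r in H0. }
assert (G1 : gcont (fun w => Cconj w * Cexp (k * w))) by apply gcont_conj_mult, Hdf.
assert (G2 : gcont (fun w => Cconj w * (Cconj w * Cexp (k * w)))) by now apply gcont_conj_mult.
assert (Hs : forall c g, gcont g -> gcont (fun w => c * g w)).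
{ intros c g Hg z; apply ccont_mult; [apply ccont_const|apply Hg]. }
set (E := fun z => Cexp (k * Cexp (Ci * z))).
set (Q := fun z => Cexp (- (2) * Ci * z)).
assert (DE : forall z, cderiv E z (k * Cexp (k * Cexp (Ci * z)) * (Ci * Cexp (Ci * z)))).
{ intros z; apply (cderiv_comp (fun z => Cexp (Ci * z)) (fun w => Cexp (k * w)));
    apply cderiv_Cexp_scal. }
assert (DQ : forall z, cderiv Q z (- (2) * Ci * Q z)) by (intros z; apply cderiv_Cexp_scal).
set (h := fun z => - (2) * Ci * Q z * E z + Q z * (k * E z * (Ci * Cexp (Ci * z)))).
assert (Hh : gcont h).
{ intros z.
  assert (ccont Q z) by (eapply cderiv_ccont, DQ).
  assert (ccont E z) by (eapply cderiv_ccont, DE).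
  assert (ccont (fun z => Cexp (Ci * z)) z) by (eapply cderiv_ccont, cderiv_Cexp_scal).
  unfold h; apply ccont_plus; repeat apply ccont_mult; auto using ccont_const. }
assert (HI : CInt h 0 (2 * PI) = 0).
{ rewrite (CInt_FTC (fun z => Q z * E z) h 0 (2 * PI) Hh).
  - assert (P1 : Cexp (Ci * (2 * PI)%R) = Cexp (Ci * 0%R)).
    { unfold Cexp; simpl; apply injective_projections; simpl;
      replace (0 * 0 + 1 * (2 * PI))%R with (2 * PI)%R by ring;
      replace (0 * 0 + 1 * 0)%R with 0%R by ring;
      rewrite ?cos_2PI, ?sin_2PI, ?cos_0, ?sin_0; f_equal; f_equal; ring. }
    assert (PQ : forall z, Q z = / (Cexp (Ci * z) * Cexp (Ci * z))).
    { intros z; rewrite <- Cexp_plus, <- Cexp_opp; unfold Q; f_equal; ring. }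
    rewrite !PQ; unfold E; rewrite P1; ring.
  - intros t; apply cderiv_mult; [apply DQ|apply DE]. }
assert (Hparts : cmean (fun w => (- (2) * (Cconj w * (Cconj w * Cexp (k * w)))
    + k * (Cconj w * Cexp (k * w)))) = 0).
{ unfold cmean.
  rewrite (CInt_ext _ (fun z => - Ci * h z)).
  - rewrite CInt_scal, HI by exact Hh; ring.
  - intros t _; unfold h, E.
    assert (Hc : Cconj (Cexp (Ci * t)) = Cexp (- (Ci * t))).
    { rewrite Cexp_conj; f_equal; apply injective_projections; simpl; ring. }
    assert (HQ : Q t = Cconj (Cexp (Ci * t)) * Cconj (Cexp (Ci * t))).
    { rewrite Hc, <- Cexp_plus; unfold Q; f_equal; ring. }
    pose proof (Cmult_conj_circle _ (Cmod_Cexp_Ci t)) as H0.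
    rewrite HQ.
    set (w := Cexp (Ci * t)) in *; set (v := Cconj w) in *; set (e := Cexp (k * w)).
    assert (Hi : Ci * Ci = - (1)) by (apply injective_projections; simpl; ring).
    transitivity (- (Ci * Ci) * (- (2) * (v * (v * e)) + k * v * (w * v) * e)); [|ring].
    rewrite Hi, H0; ring. }
rewrite cmean_plus, !cmean_scal, H1 in Hparts; auto.
set (x := cmean (fun w => Cconj w * (Cconj w * Cexp (k * w)))) in *.
transitivity ((k * k - (- (2) * x + k * k)) / 2); [field|].
rewrite Hparts; field.
Qed.

Lemma gcont_Cmod2 (f : C -> C) : gcont f -> gcont (fun w => RtoC (Cmod (f w) ^ 2)).
Proof.
intros Hf z; apply (ccont_ext (fun w => f w * Cconj (f w))).
- intros w; symmetry; apply Cmod2_conj.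
- apply ccont_mult; [apply Hf|apply ccont_conj, Hf].
Qed.

(** On the unit circle [r - r 0] is orthogonal to the conjugate of [s - s 0]. *)
Lemma disc_fun_L2 (r s : C -> C) : disc_fun r -> disc_fun s ->
  (Re (cmean (fun w => RtoC (Cmod (s w - s 0) ^ 2)))
   <= Re (cmean (fun w => RtoC (Cmod (Cconj (r w) - s w) ^ 2))))%R.
Proof.
intros Hr Hs.
set (c := s 0).
(* The difference [Cconj r - s] equals [Cconj v - u], and [u] vanishes at 0. Hence [v * u] has mean
   0, and with its conjugate it makes up the cross terms of the square. *)
set (u := fun w => s w - c); set (v := fun w => r w - Cconj c).
assert (Du : disc_fun u) by (apply disc_fun_minus; [exact Hs|apply disc_fun_const]).
assert (Dv : disc_fun v) by (apply disc_fun_minus; [exact Hr|apply disc_fun_const]).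
assert (Duv : disc_fun (fun w => v w * u w)) by now apply disc_fun_mult.
pose proof (disc_fun_mean _ Duv) as Huv; cbv beta in Huv.
replace (v 0 * u 0) with (RtoC 0) in Huv by (unfold u, c; ring).
assert (Gu := gcont_Cmod2 u (proj1 Du)).
assert (Gv := gcont_Cmod2 v (proj1 Dv)).
assert (Guv : gcont (fun w => Cconj (v w * u w))) by (intros z; apply ccont_conj, Duv).
set (A := fun w => RtoC (Cmod (u w) ^ 2) + RtoC (Cmod (v w) ^ 2)).
set (B := fun w => v w * u w + Cconj (v w * u w)).
assert (GA : gcont A) by (intros z; now apply ccont_plus).
assert (GB : gcont B) by (intros z; apply ccont_plus; [apply Duv|apply Guv]).
assert (E : cmean (fun w => RtoC (Cmod (Cconj (r w) - s w) ^ 2)) = cmean A).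
{ rewrite (cmean_ext _ (fun w => A w - B w)).
  - rewrite cmean_minus by assumption.
    assert (cmean B = 0); [|rewrite H; ring].
    unfold B; rewrite cmean_plus, (cmean_conj (fun w => v w * u w)), Huv
      by (assumption || apply Duv).
    apply injective_projections; simpl; ring.
  - intros w _; unfold A, B, u, v; rewrite !Cmod2_conj.
    rewrite !Cmult_conj, !Cminus_conj, !Cconj_conj; ring. }
rewrite E; unfold A; rewrite cmean_plus, re_plus by assumption.
change (fun w => RtoC (Cmod (s w - c) ^ 2)) with (fun w => RtoC (Cmod (u w) ^ 2)).
assert (0 <= Re (cmean (fun w => RtoC (Cmod (v w) ^ 2))))%R; [|lra].
pose proof (cmean_le (fun _ => 0) (fun w => RtoC (Cmod (v w) ^ 2))) as H.
rewrite cmean_const in H; apply H; [intros z; apply ccont_const|exact Gv|].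
intros w _; simpl; apply (pow2_ge_0 (Cmod (v w))).
Qed.

(** * The perturbed jump *)

Lemma Cmod_mult_le (x y : C) (a b : R) :
  (Cmod x <= a -> Cmod y <= b -> Cmod (x * y) <= a * b)%R.
Proof. intros; rewrite Cmod_mult; apply Rmult_le_compat; auto using Cmod_ge_0. Qed.

Lemma Cmod_plus_le (x y : C) (a b : R) :
  (Cmod x <= a -> Cmod y <= b -> Cmod (x + y) <= a + b)%R.
Proof. intros; apply Rle_trans with (1 := Cmod_triangle _ _); lra. Qed.

Lemma Cmod_minus_le (x y : C) (a b : R) :
  (Cmod x <= a -> Cmod y <= b -> Cmod (x - y) <= a + b)%R.
Proof. intros; apply Cmod_plus_le; [|rewrite Cmod_opp]; assumption. Qed.

Lemma Cmod_Cexp_le (z : C) : (Cmod (Cexp z) <= exp (Cmod z))%R.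
Proof.
rewrite Cmod_Cexp; apply exp_le.
apply Rle_trans with (1 := Rle_abs _), re_le_Cmod.
Qed.

(** The bounded expressions are the two entries of [delta], with the row ([p1], [p2]) recovered from
    ([s1], [s2]). One factor [B] comes from that recovery and one from the exponential in [delta];
    the 2 counts the terms. *)
Lemma jump_error_bound (a b e e' s1 s2 D D' : C) (B t : R) :
  (1 <= B)%R -> (Cmod a <= 1)%R -> (Cmod b <= 1)%R ->
  (Cmod e <= B)%R -> (Cmod e' <= B)%R -> (Cmod D <= t)%R -> (Cmod D' <= t)%R ->
  let p1 := s1 * a - s2 * b * e in
  let p2 := s1 * Cconj b * e' + s2 * Cconj a in
  (Cmod (p1 * D * Cconj a + p2 * D' * b * e) <= 2 * B ^ 2 * t * (Cmod s1 + Cmod s2))%R /\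
  (Cmod (- p1 * D * Cconj b * e' + p2 * D' * a) <= 2 * B ^ 2 * t * (Cmod s1 + Cmod s2))%R.
Proof.
intros HB Ha Hb He He' HD HD' p1 p2.
pose proof (Cmod_ge_0 D) as Ht; pose proof (Cmod_ge_0 s1); pose proof (Cmod_ge_0 s2).
assert (Ha' : (Cmod (Cconj a) <= 1)%R) by now rewrite Cmod_conj.
assert (Hb' : (Cmod (Cconj b) <= 1)%R) by now rewrite Cmod_conj.
set (S := (Cmod s1 + Cmod s2)%R).
assert (Hp1 : (Cmod p1 <= B * S)%R).
{ apply Rle_trans with (Cmod s1 * 1 + Cmod s2 * 1 * B)%R; [|unfold S; nra].
  apply Cmod_minus_le; repeat apply Cmod_mult_le; auto; apply Rle_refl. }
assert (Hp2 : (Cmod p2 <= B * S)%R).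
{ apply Rle_trans with (Cmod s1 * 1 * B + Cmod s2 * 1)%R; [|unfold S; nra].
  apply Cmod_plus_le; repeat apply Cmod_mult_le; auto; apply Rle_refl. }
assert (0 <= B * S * t)%R by (unfold S; apply Rmult_le_pos; [apply Rmult_le_pos|]; lra).
split.
- apply Rle_trans with (B * S * t * 1 + B * S * t * 1 * B)%R; [|nra].
  apply Cmod_plus_le; repeat apply Cmod_mult_le; auto.
- apply Rle_trans with (B * S * t * 1 * B + B * S * t * 1)%R; [|nra].
  apply Cmod_plus_le; repeat apply Cmod_mult_le; auto.
  now rewrite Cmod_opp.
Qed.

(** Here [p1], [p2] are of order zero with corrections [q1], [q2], and [m1], [m2] are the linear
    parts of [D], [D']. Each of the two terms errs by a correction times [D] or [D'], and by an
    order-zero part times a second-order remainder. The 5 and the 8 are those of [Cexp_taylor0] and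
    [Cexp_taylor1]. *)
Lemma second_order_bound (q1 q2 p1 p2 D D' m1 m2 c g f : C) (B X U : R) :
  (1 <= B)%R -> (0 <= U)%R ->
  (Cmod q1 <= B * U)%R -> (Cmod q2 <= B * U)%R -> (Cmod p1 <= 2 * B)%R -> (Cmod p2 <= 2 * B)%R ->
  (Cmod D <= 5 * Rabs X)%R -> (Cmod D' <= 5 * Rabs X)%R ->
  (Cmod (D - m1) <= 8 * X ^ 2)%R -> (Cmod (D' - m2) <= 8 * X ^ 2)%R ->
  (Cmod f <= 2 * B)%R -> (Cmod g <= 2 * B)%R ->
  (Cmod (((p1 + q1) * D * f + (p2 + q2) * D' * g) - (p1 * m1 * f + p2 * m2 * g))
    <= B ^ 2 * (20 * (Rabs X * U) + 64 * X ^ 2))%R.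
Proof.
intros HB HU Hq1 Hq2 Hp1 Hp2 HD HD' Hm1 Hm2 Hf Hg.
replace ((p1 + q1) * D * f + (p2 + q2) * D' * g - (p1 * m1 * f + p2 * m2 * g))
  with ((q1 * D * f + p1 * (D - m1) * f) + (q2 * D' * g + p2 * (D' - m2) * g)) by ring.
apply Rle_trans with
  ((B * U * (5 * Rabs X) * (2 * B) + 2 * B * (8 * X ^ 2) * (2 * B)) +
   (B * U * (5 * Rabs X) * (2 * B) + 2 * B * (8 * X ^ 2) * (2 * B)))%R; [|apply Req_le; ring].
repeat apply Cmod_plus_le; repeat apply Cmod_mult_le; auto.
Qed.

(** In the variable [w = 1 / Lambda], [p1] and [p2] are the entries of the first
    row of [P] outside the circle; [r1] and [r2] are those of the first row of
    [P exp (-i Lambda X sigma_3)] inside it, conjugated and read at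
    [Lambda = Cconj w], so that all four are holomorphic in [w]. *)
Lemma first_row_expansion (a b : C) (hab : a * Cconj a + b * Cconj b = 1) :
  exists K x0 : R, (0 < x0)%R /\
  forall (X : R) (p1 p2 r1 r2 : C -> C), (Rabs X <= x0)%R ->
    disc_fun p1 -> disc_fun p2 -> disc_fun r1 -> disc_fun r2 -> p1 0 = 1 -> p2 0 = 0 ->
    (forall w, Cmod w = 1%R ->
      Cconj (r1 w) = p1 w * Cexp (- (Ci * X * Cconj w)) * Cconj a
        + p2 w * Cexp (Ci * X * Cconj w) * b * Cexp (4 * Ci * w) /\
      Cconj (r2 w) = - p1 w * Cexp (- (Ci * X * Cconj w)) * Cconj b * Cexp (- (4 * Ci) * w)
        + p2 w * Cexp (Ci * X * Cconj w) * a) ->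
  exists l, cderiv p2 0 l /\
    (Cmod (l - - (4) * Ci * Cconj a * Cconj b
       - X * (16 * Ci * Cconj a * Cconj b * (a * Cconj a - b * Cconj b))) <= K * X ^ 2)%R.
Proof.
(* [B] bounds exp(4 i w) and its inverse on the circle. [N] is 2 * 3 * 100 * [B ^ 4]: two entries of
   [delta], each at most [2 * B ^ 2 * (5 * Rabs X)] times |s1| + |s2|, and the 3 from bounding the
   square of a sum. *)
set (B := exp 4); set (N := (600 * B ^ 4)%R).
assert (HB : (1 <= B)%R).
{ unfold B; pose proof (exp_ineq1_le 4); lra. }
assert (HN : (1 <= N)%R).
{ assert (1 <= B ^ 4)%R by (apply pow_R1_Rle; exact HB); unfold N; lra. }
(* The outer 2 is that of [cmean_bound]. The error density is
   [B ^ 2 * (20 * (Rabs X * U) + 64 * X ^ 2)]; splitting the products [Rabs X * Cmod (u1 w)] and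
   [Rabs X * Cmod (u2 w)] by 2xy <= x^2 + y^2 gives 10 times [Um], whose mean is at most
   [8 * N * X ^ 2], and 64 + 20 = 84. *)
exists (2 * (B ^ 2 * (10 * (8 * N) + 84)))%R, (/ (2 * N))%R.
split; [apply Rinv_0_lt_compat; lra|].
intros X p1 p2 r1 r2 HX Hp1 Hp2 Hr1 Hr2 Hp10 Hp20 Hjump.
assert (HX1 : (Rabs X <= 1 / 2)%R).
{ apply Rle_trans with (1 := HX); unfold Rdiv; rewrite Rmult_1_l.
  apply Rinv_le_contravar; lra. }
assert (HXN : (N * X ^ 2 <= 1 / 2)%R).
{ rewrite <- (pow2_abs X); pose proof (Rabs_pos X).
  apply (Rmult_le_compat_r (2 * N)) in HX; [|lra].
  rewrite Rinv_l in HX by lra; nra. }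
set (e := fun w => Cexp (4 * Ci * w)); set (e' := fun w => Cexp (- (4 * Ci) * w)).
assert (Hee : forall w, e w * e' w = 1).
{ intros w; unfold e, e'; rewrite <- Cexp_plus, <- Cexp_0; f_equal; ring. }
assert (He : forall w, Cmod w = 1%R -> (Cmod (e w) <= B)%R).
{ intros w Hw; apply Rle_trans with (1 := Cmod_Cexp_le _).
  rewrite !Cmod_mult, Hw, Cmod_Ci, Cmod_R, Rabs_pos_eq by lra; apply exp_le; lra. }
assert (He' : forall w, Cmod w = 1%R -> (Cmod (e' w) <= B)%R).
{ intros w Hw; apply Rle_trans with (1 := Cmod_Cexp_le _).
  rewrite Cmod_mult, Cmod_opp, Cmod_mult, Hw, Cmod_Ci, Cmod_R, Rabs_pos_eq by lra.
  apply exp_le; lra. }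
assert (De : disc_fun e) by apply disc_fun_exp.
assert (De' : disc_fun e') by apply disc_fun_exp.
set (a' := Cconj a) in *; set (b' := Cconj b) in *.
assert (Hab : (Cmod a ^ 2 + Cmod b ^ 2 = 1)%R).
{ apply RtoC_inj; rewrite RtoC_plus, !Cmod2_conj; exact hab. }
assert (Ha : (Cmod a <= 1)%R) by (pose proof (Cmod_ge_0 a); nra).
assert (Hb : (Cmod b <= 1)%R) by (pose proof (Cmod_ge_0 b); nra).
assert (Ha' : (Cmod a' <= 1)%R) by (unfold a'; now rewrite Cmod_conj).
assert (Hb' : (Cmod b' <= 1)%R) by (unfold b'; now rewrite Cmod_conj).
set (s1 := fun w => p1 w * a' + p2 w * b * e w).
set (s2 := fun w => p2 w * a - p1 w * b' * e' w).
assert (Ds1 : disc_fun s1).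
{ unfold s1; apply disc_fun_plus; repeat apply disc_fun_mult; auto using disc_fun_const. }
assert (Ds2 : disc_fun s2).
{ unfold s2; apply disc_fun_minus; repeat apply disc_fun_mult; auto using disc_fun_const. }
assert (Es1 : s1 0 = a') by (unfold s1; rewrite Hp10, Hp20; ring).
assert (Es2 : s2 0 = - b').
{ unfold s2, e'; rewrite Hp10, Hp20, Cmult_0_r, Cexp_0; ring. }
(* The row p is recovered by inverting a matrix of determinant 1, by [hab] and [Hee]. *)
assert (Ep1 : forall w, p1 w = s1 w * a - s2 w * b * e w).
{ intros w; unfold s1, s2.
  transitivity (p1 w * (a * a' + b * b' * (e w * e' w))); [|ring].
  rewrite Hee, Cmult_1_r, hab; ring. }
assert (Ep2 : forall w, p2 w = s1 w * b' * e' w + s2 w * a').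
{ intros w; unfold s1, s2.
  transitivity (p2 w * (a * a' + b * b' * (e w * e' w))); [|ring].
  rewrite Hee, Cmult_1_r, hab; ring. }
(* On the circle [Cconj w] is Lambda. Here [D] and [D'] denote the diagonal entries of exp(-i Lambda
   X sigma_3) with 1 already subtracted. *)
set (D := fun w => Cexp (- (Ci * X * Cconj w)) - 1).
set (D' := fun w => Cexp (Ci * X * Cconj w) - 1).
set (d1 := fun w => Cconj (r1 w) - s1 w); set (d2 := fun w => Cconj (r2 w) - s2 w).
assert (Ed1 : forall w, Cmod w = 1%R -> d1 w = p1 w * D w * a' + p2 w * D' w * b * e w).
{ intros w Hw; unfold d1; rewrite (proj1 (Hjump w Hw)); unfold s1, D, D', e; ring. }
assert (Ed2 : forall w, Cmod w = 1%R -> d2 w = - p1 w * D w * b' * e' w + p2 w * D' w * a).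
{ intros w Hw; unfold d2; rewrite (proj2 (Hjump w Hw)); unfold s2, D, D', e'; ring. }
assert (HXw : forall w, Cmod w = 1%R -> Cmod (Ci * X * Cconj w) = Rabs X).
{ intros w Hw; rewrite !Cmod_mult, Cmod_conj, Hw, Cmod_Ci, Cmod_R; ring. }
assert (HD : forall w, Cmod w = 1%R -> (Cmod (D w) <= 5 * Rabs X)%R).
{ intros w Hw; rewrite <- (HXw w Hw), <- (Cmod_opp (Ci * X * Cconj w)); apply Cexp_taylor0.
  rewrite Cmod_opp, HXw; assumption. }
assert (HD' : forall w, Cmod w = 1%R -> (Cmod (D' w) <= 5 * Rabs X)%R).
{ intros w Hw; rewrite <- (HXw w Hw); apply Cexp_taylor0; rewrite HXw; assumption. }
assert (HD2 : forall w, Cmod w = 1%R ->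
  (Cmod (D w - - (Ci * X * Cconj w)) <= 8 * X ^ 2)%R).
{ intros w Hw; rewrite <- pow2_abs, <- (HXw w Hw), <- (Cmod_opp (Ci * X * Cconj w)).
  apply Cexp_taylor1; rewrite Cmod_opp, HXw; assumption. }
assert (HD2' : forall w, Cmod w = 1%R -> (Cmod (D' w - Ci * X * Cconj w) <= 8 * X ^ 2)%R).
{ intros w Hw; rewrite <- pow2_abs, <- (HXw w Hw).
  apply Cexp_taylor1; rewrite HXw; assumption. }
assert (Gr1 : gcont (fun w => Cconj (r1 w))) by (intros z; apply ccont_conj, Hr1).
assert (Gr2 : gcont (fun w => Cconj (r2 w))) by (intros z; apply ccont_conj, Hr2).
assert (Gd1 : gcont d1) by (intros z; apply ccont_minus; [apply Gr1|apply Ds1]).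
assert (Gd2 : gcont d2) by (intros z; apply ccont_minus; [apply Gr2|apply Ds2]).
assert (Gs : forall c g, gcont g -> gcont (fun w => c * g w)).
{ intros c g Hg z; apply ccont_mult; [apply ccont_const|apply Hg]. }
assert (Gp : forall f g, gcont f -> gcont g -> gcont (fun w => f w + g w)).
{ intros f g Hf Hg z; apply ccont_plus; [apply Hf|apply Hg]. }
assert (Gm : forall f g, gcont f -> gcont g -> gcont (fun w => f w - g w)).
{ intros f g Hf Hg z; apply ccont_minus; [apply Hf|apply Hg]. }
assert (Gc : forall c, gcont (fun _ => c)) by (intros c z; apply ccont_const).
set (u1 := fun w => s1 w - s1 0); set (u2 := fun w => s2 w - s2 0).
assert (Gu1 : gcont u1) by (apply (Gm s1); [apply Ds1|apply Gc]).
assert (Gu2 : gcont u2) by (apply (Gm s2); [apply Ds2|apply Gc]).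
set (Um := fun w => RtoC (Cmod (u1 w) ^ 2) + RtoC (Cmod (u2 w) ^ 2)).
set (Vm := fun w => RtoC (Cmod (d1 w) ^ 2) + RtoC (Cmod (d2 w) ^ 2)).
assert (GUm : gcont Um) by (apply Gp; now apply gcont_Cmod2).
assert (GVm : gcont Vm) by (apply Gp; now apply gcont_Cmod2).
assert (HUm : forall w, Re (Um w) = (Cmod (u1 w) ^ 2 + Cmod (u2 w) ^ 2)%R).
{ intros w; unfold Um; now rewrite re_plus, !re_RtoC. }
assert (HVm : forall w, Re (Vm w) = (Cmod (d1 w) ^ 2 + Cmod (d2 w) ^ 2)%R).
{ intros w; unfold Vm; now rewrite re_plus, !re_RtoC. }
(* The projection step: the distance of [s] from its value at 0 is controlled by the mismatch [d1],
   [d2] on the circle. *)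
assert (HUV : (Re (cmean Um) <= Re (cmean Vm))%R).
{ unfold Um, Vm; rewrite !cmean_plus, !re_plus by now apply gcont_Cmod2.
  apply Rplus_le_compat; now apply disc_fun_L2. }
assert (HV : (Re (cmean Vm) <= N * X ^ 2 * (Re (cmean Um) + 4))%R).
{ set (g := fun w => RtoC (N * X ^ 2) * (Um w + RtoC 4)).
  replace (N * X ^ 2 * (Re (cmean Um) + 4))%R with (Re (cmean g)).
  2:{ unfold g; rewrite cmean_scal, cmean_plus, cmean_const, re_scal_l, re_plus, re_RtoC
        by auto; reflexivity. }
  apply cmean_le; [exact GVm|unfold g; auto|].
  intros w Hw; rewrite HVm; unfold g; rewrite re_scal_l, re_plus, re_RtoC, HUm.
  destruct (jump_error_bound a b (e w) (e' w) (s1 w) (s2 w) (D w) (D' w) B (5 * Rabs X))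
    as [J1 J2]; auto.
  fold a' b' in J1, J2; rewrite <- Ep1, <- Ep2 in J1, J2.
  rewrite <- (Ed1 w Hw) in J1; rewrite <- (Ed2 w Hw) in J2.
  assert (S1 : (Cmod (s1 w) <= Cmod (u1 w) + 1)%R).
  { replace (s1 w) with (u1 w + a') by (unfold u1; rewrite Es1; ring).
    apply Cmod_plus_le; [apply Rle_refl|exact Ha']. }
  assert (S2 : (Cmod (s2 w) <= Cmod (u2 w) + 1)%R).
  { replace (s2 w) with (u2 w - b') by (unfold u2; rewrite Es2; ring).
    apply Cmod_minus_le; [apply Rle_refl|exact Hb']. }
  set (x := Cmod (u1 w)) in *; set (y := Cmod (u2 w)) in *.
  set (Q := (x + y + 2)%R).
  assert (HQ : (Q ^ 2 <= 3 * (x ^ 2 + y ^ 2 + 4))%R).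
  { unfold Q; pose proof (pow2_ge_0 (x - y)); pose proof (pow2_ge_0 (x - 2));
    pose proof (pow2_ge_0 (y - 2)); nra. }
  set (c := (2 * B ^ 2 * (5 * Rabs X))%R) in *.
  assert (Hc : (0 <= c)%R).
  { unfold c; pose proof (Rabs_pos X); pose proof (pow2_ge_0 B); apply Rmult_le_pos; lra. }
  assert (Hc2 : (c ^ 2 = 100 * B ^ 4 * X ^ 2)%R).
  { unfold c; rewrite <- (pow2_abs X); ring. }
  assert (Hsq : forall z, (Cmod z <= c * (Cmod (s1 w) + Cmod (s2 w)) -> Cmod z ^ 2 <= c ^ 2 * Q ^ 2)%R).
  { intros z Hz; rewrite <- Rpow_mult_distr; apply pow_incr; split; [apply Cmod_ge_0|].
    apply Rle_trans with (1 := Hz); apply Rmult_le_compat_l; [exact Hc|unfold Q; lra]. }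
  apply Rle_trans with (c ^ 2 * Q ^ 2 + c ^ 2 * Q ^ 2)%R; [apply Rplus_le_compat; auto|].
  apply Rle_trans with (2 * c ^ 2 * (3 * (x ^ 2 + y ^ 2 + 4)))%R.
  - pose proof (pow2_ge_0 c); nra.
  - rewrite Hc2; apply Req_le; unfold N; ring. }
(* Absorption: v <= t (v + 4) with t <= 1/2 gives v <= 8 t. *)
assert (HU : (Re (cmean Um) <= 8 * N * X ^ 2)%R).
{ rewrite Rmult_assoc; set (t := (N * X ^ 2)%R) in *; set (v := Re (cmean Um)) in *.
  assert (Ht : (0 <= t)%R) by (unfold t; pose proof (pow2_ge_0 X); apply Rmult_le_pos; lra).
  destruct (Rle_lt_dec v 0) as [Hv|Hv]; nra. }
set (m1 := cmean (fun w => Cconj w * s1 w)); set (m2 := cmean (fun w => Cconj w * s2 w)).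
(* The weights are the coefficients of [s1] and [s2] in [p2], up to [e']. In the mean of
   [Cconj w * T w] the parts from [r1], [r2] drop out, being conjugates of functions that vanish at
   0; only the derivatives [m1], [m2] of [s1], [s2] at 0 remain. *)
set (T := fun w => b' * d1 w + a' * d2 w).
assert (GT : gcont T) by (apply Gp; now apply Gs).
assert (ET : cmean (fun w => Cconj w * T w) = - (b' * m1 + a' * m2)).
{ assert (Hq : forall r, disc_fun r -> cmean (fun w => Cconj w * Cconj (r w)) = 0).
  { intros r Dr.
    rewrite (cmean_ext _ (fun w => Cconj (w * r w))) by (intros; now rewrite Cmult_conj).
    assert (Dwr := disc_fun_mult _ _ disc_fun_id Dr).
    rewrite cmean_conj by apply Dwr; rewrite (disc_fun_mean _ Dwr).
    rewrite Cmult_0_l; apply injective_projections; simpl; ring. }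
  assert (G1 := gcont_conj_mult _ Gr1); assert (G2 := gcont_conj_mult _ Gr2).
  assert (G3 := gcont_conj_mult _ (proj1 Ds1)); assert (G4 := gcont_conj_mult _ (proj1 Ds2)).
  rewrite (cmean_ext _ (fun w => b' * (Cconj w * Cconj (r1 w) - Cconj w * s1 w)
    + a' * (Cconj w * Cconj (r2 w) - Cconj w * s2 w))) by (intros; unfold T, d1, d2; ring).
  rewrite cmean_plus, !cmean_scal, !cmean_minus by auto.
  rewrite !Hq by assumption; fold m1 m2; ring. }
(* The product rule for [p2 = b' * (s1 * e') + a' * s2] at 0: the explicit term is the derivative of
   [e'] times [s1 0 = a'], the rest is [ET]. *)
exists (- (4) * Ci * a' * b' - cmean (fun w => Cconj w * T w)); split.
{ rewrite ET.
  apply (cderiv_local (fun w => b' * (s1 w * e' w) + a' * s2 w) p2 0 _ 1); [lra|..].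
  { intros w _; rewrite (Ep2 w); ring. }
  replace (- (4) * Ci * a' * b' - - (b' * m1 + a' * m2))
    with (b' * (m1 * e' 0 + s1 0 * (- (4 * Ci) * e' 0)) + a' * m2).
  2:{ rewrite Es1; unfold e'; rewrite Cmult_0_r, Cexp_0; ring. }
  apply cderiv_plus; apply cderiv_scal; [|now apply disc_fun_derive_0].
  apply cderiv_mult; [now apply disc_fun_derive_0|apply cderiv_Cexp_scal]. }
(* [X * Cconj w * L w] is the part of [T] linear in [X], computed with [s] frozen at its value at 0.
   The constant is written with [Cexp (0 * w)] so that [cmean_conj2_exp] treats all three terms
   alike; the constant contributes 0 and the two exponentials give -8. *)
set (L := fun w => 2 * Ci * a' * b' *
  ((a * a' * Cexp (- (4 * Ci) * w) - b * b' * Cexp (4 * Ci * w))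
    + (b * b' - a * a') * Cexp (0 * w))).
assert (EL : cmean (fun w => Cconj w * (Cconj w * L w))
  = - (16) * Ci * a' * b' * (a * a' - b * b')).
{ assert (GE : forall k, gcont (fun w => Cconj w * (Cconj w * Cexp (k * w)))).
  { intros k; do 2 apply gcont_conj_mult; apply disc_fun_exp. }
  rewrite (cmean_ext _ (fun w => 2 * Ci * a' * b' *
    ((a * a' * (Cconj w * (Cconj w * Cexp (- (4 * Ci) * w)))
      - b * b' * (Cconj w * (Cconj w * Cexp (4 * Ci * w))))
    + (b * b' - a * a') * (Cconj w * (Cconj w * Cexp (0 * w))))))
    by (intros; unfold L; ring).
  rewrite cmean_scal, cmean_plus, cmean_minus, !cmean_scal, !cmean_conj2_exp by auto.
  assert (Hi : Ci * Ci = - (1)) by (apply injective_projections; simpl; ring).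
  transitivity (2 * Ci * a' * b' * (8 * (Ci * Ci)) * (a * a' - b * b')); [field|].
  rewrite Hi; ring. }
assert (GL : gcont L).
{ unfold L; apply Gs, Gp; [apply Gm|]; apply Gs, disc_fun_exp. }
assert (GTL : gcont (fun w => Cconj w * T w - X * (Cconj w * (Cconj w * L w)))).
{ apply Gm; [|apply Gs]; repeat apply gcont_conj_mult; assumption. }
set (W := fun w => Cconj w * T w - X * (Cconj w * (Cconj w * L w))) in *.
match goal with |- (Cmod ?z <= _)%R => replace z with (- cmean W) end.
2:{ unfold W; rewrite cmean_minus, cmean_scal, EL by (try apply Gs; repeat apply gcont_conj_mult; assumption).
    ring. }
rewrite Cmod_opp.
set (g := fun w => RtoC (B ^ 2) * (RtoC 10 * Um w + RtoC (84 * X ^ 2))).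
apply Rle_trans with (2 * Re (cmean g))%R.
2:{ unfold g; rewrite cmean_scal, cmean_plus, cmean_scal, cmean_const by auto.
    rewrite re_scal_l, re_plus, re_scal_l, re_RtoC.
    pose proof (pow2_ge_0 B); nra. }
apply cmean_bound; [exact GTL|unfold g; auto|].
intros w Hw; unfold g; rewrite re_scal_l, re_plus, re_scal_l, re_RtoC, HUm.
set (k := Ci * X * Cconj w).
(* Both entries of p are split into their value for frozen [s] and a part linear in [u1], [u2],
   which is the shape [second_order_bound] expects. *)
assert (EW : W w = Cconj w *
  ((((a * a' + b * b' * e w) + (u1 w * a - u2 w * b * e w)) * D w * (a' * b' * (1 - e' w))
   + (a' * b' * (e' w - 1) + (u1 w * b' * e' w + u2 w * a')) * D' w * (b * b' * e w + a * a'))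
   - ((a * a' + b * b' * e w) * (- k) * (a' * b' * (1 - e' w))
     + a' * b' * (e' w - 1) * k * (b * b' * e w + a * a')))).
{ unfold W, T; rewrite Ed1, Ed2 by exact Hw.
  replace ((a * a' + b * b' * e w) + (u1 w * a - u2 w * b * e w)) with (p1 w).
  2:{ rewrite (Ep1 w); unfold u1, u2; rewrite Es1, Es2; ring. }
  replace (a' * b' * (e' w - 1) + (u1 w * b' * e' w + u2 w * a')) with (p2 w).
  2:{ rewrite (Ep2 w); unfold u1, u2; rewrite Es1, Es2; ring. }
  assert (EL' : X * (Cconj w * L w) = (a * a' + b * b' * e w) * (- k) * (a' * b' * (1 - e' w))
     + a' * b' * (e' w - 1) * k * (b * b' * e w + a * a')).
  { unfold L, k; fold (e w) (e' w); rewrite Cmult_0_l, Cexp_0.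
    transitivity (2 * (Ci * X * Cconj w) * a' * b' *
      (a * a' * e' w - b * b' * e w + (b * b' * (e w * e' w) - a * a'))); [|ring].
    rewrite Hee; ring. }
  rewrite <- EL'; ring. }
rewrite EW, Cmod_mult, Cmod_conj, Hw, Rmult_1_l.
set (U := (Cmod (u1 w) + Cmod (u2 w))%R).
pose proof (Cmod_ge_0 (u1 w)) as Hu1; pose proof (Cmod_ge_0 (u2 w)) as Hu2.
specialize (He w Hw); specialize (He' w Hw).
assert (Hb2 : (Cmod (b * b') <= 1)%R).
{ rewrite <- (Rmult_1_r 1); now apply Cmod_mult_le. }
assert (Ha2 : (Cmod (a * a') <= 1)%R).
{ rewrite <- (Rmult_1_r 1); now apply Cmod_mult_le. }
assert (Hab2 : (Cmod (a' * b') <= 1)%R).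
{ rewrite <- (Rmult_1_r 1); now apply Cmod_mult_le. }
assert (Hg1 : (Cmod (b * b' * e w) <= B)%R).
{ rewrite <- (Rmult_1_l B); now apply Cmod_mult_le. }
assert (H1 : (Cmod 1 <= B)%R) by now rewrite Cmod_1.
apply Rle_trans with (B ^ 2 * (20 * (Rabs X * U) + 64 * X ^ 2))%R.
- apply second_order_bound; auto.
  + unfold U; lra.
  + apply Rle_trans with (Cmod (u1 w) * 1 + Cmod (u2 w) * 1 * B)%R; [|unfold U; nra].
    apply Cmod_minus_le; repeat apply Cmod_mult_le; auto; apply Rle_refl.
  + apply Rle_trans with (Cmod (u1 w) * 1 * B + Cmod (u2 w) * 1)%R; [|unfold U; nra].
    apply Cmod_plus_le; repeat apply Cmod_mult_le; auto; apply Rle_refl.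
  + rewrite double; apply Cmod_plus_le; lra.
  + apply Rle_trans with (1 * (B + B))%R; [|lra].
    apply Cmod_mult_le; [assumption|now apply Cmod_minus_le].
  + apply Rle_trans with (1 * (B + B))%R; [|lra].
    apply Cmod_mult_le; [assumption|now apply Cmod_minus_le].
  + rewrite double; apply Cmod_plus_le; lra.
- apply Rmult_le_compat_l; [apply pow2_ge_0|].
  rewrite <- (pow2_abs X); unfold U.
  pose proof (pow2_ge_0 (Rabs X - Cmod (u1 w))); pose proof (pow2_ge_0 (Rabs X - Cmod (u2 w))).
  nra.
Qed.

(** * From the Riemann-Hilbert problem to the disc *)

(** Outside the disc the extension is constant along rays, equal to [B] at w / |w|. Continuity at a
    point of the circle then needs the boundary limit from inside and the continuity of [B] along
    the circle. *)
Lemma disc_fun_extension (f B : C -> C) (c : C) :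
  (forall w, (0 < Cmod w < 1)%R -> exists l, cderiv f w l) ->
  (forall eps, (0 < eps)%R -> exists d, (0 < d)%R /\
    forall w, (0 < Cmod w < d)%R -> (Cmod (f w - c) < eps)%R) ->
  (forall z, Cmod z = 1%R -> forall eps, (0 < eps)%R -> exists d, (0 < d)%R /\
    forall w, (0 < Cmod w < 1)%R -> (Cmod (w - z) < d)%R -> (Cmod (f w - B z) < eps)%R) ->
  (forall z, Cmod z = 1%R -> forall eps, (0 < eps)%R -> exists d, (0 < d)%R /\
    forall w, Cmod w = 1%R -> (Cmod (w - z) < d)%R -> (Cmod (B w - B z) < eps)%R) ->
  exists F, disc_fun F /\ F 0 = c /\
    (forall w, (0 < Cmod w < 1)%R -> F w = f w) /\ (forall w, Cmod w = 1%R -> F w = B w).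
Proof.
intros Hf H0 HB HBB.
set (F := fun w => if Ceq_dec w 0 then c else
  if Rlt_dec (Cmod w) 1 then f w else B (w * / Cmod w)).
assert (F0 : F 0 = c) by (unfold F; destruct (Ceq_dec 0 0); congruence).
assert (F1 : forall w, (0 < Cmod w < 1)%R -> F w = f w).
{ intros w Hw; unfold F; destruct (Ceq_dec w 0) as [->|_].
  - rewrite Cmod_0 in Hw; lra.
  - destruct (Rlt_dec (Cmod w) 1); [reflexivity|lra]. }
assert (F2 : forall w, (1 <= Cmod w)%R -> F w = B (w * / Cmod w)).
{ intros w Hw; unfold F; destruct (Ceq_dec w 0) as [->|_].
  - rewrite Cmod_0 in Hw; lra.
  - destruct (Rlt_dec (Cmod w) 1); [lra|reflexivity]. }
assert (Hloc : forall w, (0 < Cmod w < 1)%R -> exists d, (0 < d)%R /\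
  forall v, (Cmod (v - w) < d)%R -> f v = F v).
{ intros w Hw; exists (Rmin (Cmod w) (1 - Cmod w)); split; [apply Rmin_pos; lra|].
  intros v Hv; symmetry; apply F1.
  pose proof (Rmin_l (Cmod w) (1 - Cmod w)); pose proof (Rmin_r (Cmod w) (1 - Cmod w)).
  pose proof (Cmod_reverse_triangle v w) as Ht; apply Rabs_le_between in Ht; lra. }
exists F; split; [split|split; [exact F0|split; [exact F1|]]].
- intros w.
  destruct (Ceq_dec w 0) as [->|Hw0]; [|apply Cmod_gt_0 in Hw0; destruct (Rlt_le_dec (Cmod w) 1) as [Hw1|Hw1]].
  + intros eps He; destruct (H0 eps He) as (d & Hd & H).
    exists (Rmin d 1); split; [apply Rmin_pos; lra|]; intros w Hw.
    pose proof (Rmin_l d 1); pose proof (Rmin_r d 1).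
    replace (w - 0) with w in Hw by ring; rewrite F0.
    destruct (Ceq_dec w 0) as [->|Hw0]; [rewrite F0; now apply Cmod_minus_self|].
    apply Cmod_gt_0 in Hw0.
    rewrite F1 by lra; apply H; lra.
  + destruct (Hf w (conj Hw0 Hw1)) as [l Hl].
    destruct (Hloc w (conj Hw0 Hw1)) as (d & Hd & H).
    apply (ccont_local f F w d Hd H); now apply cderiv_ccont with l.
  + assert (Hproj : forall v, (1 <= Cmod v)%R -> Cmod (v * / Cmod v) = 1%R).
    { intros v Hv; rewrite Cmod_mult, Cmod_inv, Cmod_R, Rabs_pos_eq; [field|..]; try lra.
      intros Hc; apply RtoC_inj in Hc; lra. }
    intros eps He.
    destruct (HBB _ (Hproj w Hw1) eps He) as (d2 & Hd2 & H2).
    assert (Hpc : ccont (fun v => v * / Cmod v) w).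
    { apply ccont_mult; [apply ccont_id|]; apply ccont_inv.
      - apply (ccont_Cmod (fun v => v)), ccont_id.
      - intros Hc; apply RtoC_inj in Hc; lra. }
    destruct (Hpc d2 Hd2) as (d3 & Hd3 & H3).
    rewrite F2 by exact Hw1.
    assert (Hin : exists d1, (0 < d1)%R /\ forall v, (0 < Cmod v < 1)%R -> (Cmod (v - w) < d1)%R ->
      (Cmod (f v - B (w * / Cmod w)%C) < eps)%R).
    { destruct (Req_dec (Cmod w) 1) as [Hw|Hw].
      - replace (w * / Cmod w) with w by (rewrite Hw; field).
        now apply HB.
      - exists (Cmod w - 1)%R; split; [lra|]; intros v Hv Hvw.
        pose proof (Cmod_reverse_triangle v w) as Ht; apply Rabs_le_between in Ht; lra. }
    destruct Hin as (d1 & Hd1 & H1).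
    exists (Rmin 1 (Rmin d1 d3)); split; [repeat apply Rmin_pos; lra|]; intros v Hv.
    pose proof (Rmin_l 1 (Rmin d1 d3)); pose proof (Rmin_r 1 (Rmin d1 d3)).
    pose proof (Rmin_l d1 d3); pose proof (Rmin_r d1 d3).
    pose proof (Cmod_reverse_triangle v w) as Ht; apply Rabs_le_between in Ht.
    destruct (Rlt_le_dec (Cmod v) 1) as [Hv1|Hv1].
    * rewrite F1 by lra; apply H1; lra.
    * rewrite F2 by exact Hv1.
      apply H2; [now apply Hproj|apply H3; lra].
- intros w Hw; destruct (Hf w Hw) as [l Hl]; exists l.
  destruct (Hloc w Hw) as (d & Hd & H).
  now apply (cderiv_local f F w l d Hd H).
- intros w Hw; rewrite F2, Hw by lra; f_equal; field.
Qed.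

(** Balls in [C] are those of a product, hence [eps / 2] for each coordinate. *)
Lemma filterlim_Cmod {F : (C -> Prop) -> Prop} {FF : Filter F} (f : C -> C) (l : C) (eps : R) :
  filterlim f F (locally l) -> (0 < eps)%R -> F (fun z => (Cmod (f z - l) < eps)%R).
Proof.
intros H He.
apply (H (fun y => (Cmod (y - l) < eps)%R)).
assert (He2 : (0 < eps / 2)%R) by lra.
exists (mkposreal _ He2); intros y [Hy1 Hy2].
apply Rle_lt_trans with (1 := Cmod_le_Re_Im _).
change (Rabs (Re (y - l)) < eps / 2)%R in Hy1.
change (Rabs (Im (y - l)) < eps / 2)%R in Hy2.
lra.
Qed.

Lemma locally_Cmod (z : C) (Q : C -> Prop) :
  locally z Q -> exists d, (0 < d)%R /\ forall w, (Cmod (w - z) < d)%R -> Q w.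
Proof.
intros [d Hd]; exists d; split; [apply cond_pos|]; intros w Hw.
apply Hd, C_NormedModule_mixin_compat1, Hw.
Qed.

Lemma filterlim_of_Cmod {F : (C -> Prop) -> Prop} {FF : Filter F} (f : C -> C) (l : C) :
  (forall eps, (0 < eps)%R -> F (fun z => (Cmod (f z - l) < eps)%R)) -> filterlim f F (locally l).
Proof.
intros H Q [d Hd].
apply filter_imp with (2 := H d (cond_pos d)); intros z Hz.
apply Hd, C_NormedModule_mixin_compat1, Hz.
Qed.

Lemma entry_mmul (A B : M2) (i j : nat) : (i < 2)%nat -> (j < 2)%nat ->
  entry (mmul A B) i j = entry A i 0 * entry B 0 j + entry A i 1 * entry B 1 j.
Proof.
intros Hi Hj; unfold entry, mmul, Mmult.
rewrite coeff_mat_bij by assumption.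
simpl pred; rewrite sum_Sn, sum_O; reflexivity.
Qed.

Lemma entry_mat22 (a b c d : C) :
  entry (mat22 a b c d) 0 0 = a /\ entry (mat22 a b c d) 0 1 = b /\
  entry (mat22 a b c d) 1 0 = c /\ entry (mat22 a b c d) 1 1 = d.
Proof. repeat split. Qed.

(** Conjugation by a diagonal matrix leaves the diagonal of G alone and multiplies the other entries
    by exponentials of twice the phase. These are written as products of a factor entire in [L] and
    one analytic at infinity, to be sent to opposite sides of the circle. *)
Lemma entry_mul_jump (M : M2) (a b c d : C) (X : R) (L : C) :
  entry (mmul M (jump (mat22 a b c d) X 0 L)) 0 0 = entry M 0 0 * a
    + entry M 0 1 * c * (Cexp (2 * Ci * X * L) * Cexp (4 * Ci * / L)) /\
  entry (mmul M (jump (mat22 a b c d) X 0 L)) 0 1 =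
    entry M 0 0 * b * (Cexp (- (2 * Ci * X * L)) * Cexp (- (4 * Ci) * / L))
    + entry M 0 1 * d.
Proof.
unfold jump, exp_sigma3; rewrite !entry_mmul by lia.
rewrite !(proj1 (entry_mat22 _ _ _ _)), !(proj1 (proj2 (entry_mat22 _ _ _ _))).
rewrite !(proj1 (proj2 (proj2 (entry_mat22 _ _ _ _)))), !(proj2 (proj2 (proj2 (entry_mat22 _ _ _ _)))).
set (p := phase X 0 L).
replace (- (- Ci * p)) with (Ci * p) by ring.
replace (- Ci * p) with (- (Ci * p)) by ring.
assert (Hp : 2 * Ci * X * L + 4 * Ci * / L = Ci * p + Ci * p).
{ unfold p, phase; unfold Cdiv; ring. }
assert (Hm : - (2 * Ci * X * L) + - (4 * Ci) * / L = - (Ci * p) + - (Ci * p)).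
{ transitivity (- (2 * Ci * X * L + 4 * Ci * / L)); [ring|rewrite Hp; ring]. }
rewrite <- !Cexp_plus, Hp, Hm, !Cexp_plus.
pose proof (Cexp_opp (Ci * p)) as Ho; pose proof (Cexp_neq_0 (Ci * p)) as Hn.
rewrite Ho; split; field; exact Hn.
Qed.

Lemma boundary_value_Cmod (D : C -> Prop) (P B : C -> M2) (z : C) (i j : nat) (eps : R) :
  boundary_value D P B -> Cmod z = 1%R -> (i < 2)%nat -> (j < 2)%nat -> (0 < eps)%R ->
  exists d, (0 < d)%R /\ forall w, (Cmod (w - z) < d)%R ->
    (D w -> (Cmod (entry (P w) i j - entry (B z) i j) < eps)%R) /\
    (Cmod w = 1%R -> (Cmod (entry (B w) i j - entry (B z) i j) < eps)%R).
Proof.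
intros HB Hz Hi Hj He; destruct (HB z Hz) as [H1 H2].
specialize (H1 i j Hi Hj); specialize (H2 i j Hi Hj).
apply (filterlim_Cmod _ _ eps) in H1; [|exact He].
apply (filterlim_Cmod _ _ eps) in H2; [|exact He].
destruct (locally_Cmod _ _ H1) as (d1 & Hd1 & H1').
destruct (locally_Cmod _ _ H2) as (d2 & Hd2 & H2').
exists (Rmin d1 d2); split; [now apply Rmin_pos|]; intros w Hw.
pose proof (Rmin_l d1 d2); pose proof (Rmin_r d1 d2); split; intros Hd.
- apply H1'; [lra|exact Hd].
- apply H2'; [lra|exact Hd].
Qed.

Lemma Cmod_gt_0_neq (w : C) : (0 < Cmod w)%R -> w <> 0.
Proof. intros H; now apply Cmod_gt_0. Qed.

(** Inversion sends infinity to 0, where the normalisation of [P] becomes the value of the extended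
    function. *)
Lemma exterior_disc_fun (P B : C -> M2) (i j : nat) : (i < 2)%nat -> (j < 2)%nat ->
  analytic_on (fun L => Cmod L <> 1%R) P -> boundary_value exterior P B ->
  mlim P C_infty id2 ->
  exists F, disc_fun F /\ F 0 = entry id2 i j /\
    (forall w, (0 < Cmod w < 1)%R -> F w = entry (P (/ w)) i j) /\
    (forall w, Cmod w = 1%R -> F w = entry (B (/ w)) i j).
Proof.
intros Hi Hj HP HB Hinf.
assert (Hinv : forall w, (0 < Cmod w < 1)%R -> (1 < Cmod (/ w))%R).
{ intros w Hw; rewrite Cmod_inv by (apply Cmod_gt_0_neq; lra).
  rewrite <- Rinv_1; apply Rinv_lt_contravar; lra. }
assert (Hinv1 : forall w, Cmod w = 1%R -> Cmod (/ w) = 1%R).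
{ intros w Hw; rewrite Cmod_inv, Hw by (apply Cmod_gt_0_neq; lra); apply Rinv_1. }
apply (disc_fun_extension (fun w => entry (P (/ w)) i j) (fun w => entry (B (/ w)) i j)).
- intros w Hw; specialize (Hinv w Hw).
  destruct (cderiv_of_derive _ _ (HP i j Hi Hj (/ w) ltac:(lra))) as [l Hl].
  eexists; apply (cderiv_comp Cinv (fun z => entry (P z) i j)); [|exact Hl].
  apply cderiv_inv, Cmod_gt_0_neq; lra.
- intros eps He.
  destruct (filterlim_Cmod _ _ eps (Hinf i j Hi Hj) He) as [M HM].
  exists (/ (Rabs M + 1))%R; pose proof (Rabs_pos M).
  split; [apply Rinv_0_lt_compat; lra|]; intros w Hw.
  apply HM; rewrite Cmod_inv by (apply Cmod_gt_0_neq; lra).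
  apply Rle_lt_trans with (1 := Rle_abs M).
  apply Rlt_trans with (Rabs M + 1)%R; [lra|].
  rewrite <- (Rinv_inv (Rabs M + 1)); apply Rinv_lt_contravar; [|lra].
  apply Rmult_lt_0_compat; lra.
- intros z Hz eps He.
  destruct (boundary_value_Cmod _ _ _ _ i j eps HB (Hinv1 z Hz) Hi Hj He) as (d & Hd & H).
  destruct (ccont_inv_id z (Cmod_gt_0_neq z ltac:(lra)) d Hd) as (d' & Hd' & H').
  exists d'; split; [exact Hd'|]; intros w Hw Hwz.
  apply (proj1 (H (/ w) (H' w Hwz))); now apply Hinv.
- intros z Hz eps He.
  destruct (boundary_value_Cmod _ _ _ _ i j eps HB (Hinv1 z Hz) Hi Hj He) as (d & Hd & H).
  destruct (ccont_inv_id z (Cmod_gt_0_neq z ltac:(lra)) d Hd) as (d' & Hd' & H').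
  exists d'; split; [exact Hd'|]; intros w Hw Hwz.
  apply (proj2 (H (/ w) (H' w Hwz))); now apply Hinv1.
Qed.

(** Reflection keeps the interior in place, and on the circle [Cconj w] is [/ w]; so the boundary
    values are read at the same Lambda as in [exterior_disc_fun]. *)
Lemma interior_disc_fun (P B : C -> M2) (i j : nat) : (i < 2)%nat -> (j < 2)%nat ->
  analytic_on (fun L => Cmod L <> 1%R) P -> boundary_value Defs.interior P B ->
  exists F, disc_fun F /\
    (forall w, Cmod w = 1%R -> F w = Cconj (entry (B (Cconj w)) i j)).
Proof.
intros Hi Hj HP HB.
set (f := fun w => Cconj (entry (P (Cconj w)) i j)).
assert (Df : forall w, (Cmod w < 1)%R -> exists l, cderiv f w l).
{ intros w Hw.
  destruct (cderiv_of_derive _ _ (HP i j Hi Hj (Cconj w) ltac:(cbv beta; rewrite Cmod_conj; lra))) as [l Hl].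
  exists (Cconj l); now apply (cderiv_conj_conj (fun z => entry (P z) i j)). }
assert (Hconj : forall w z, Cmod (Cconj w - Cconj z) = Cmod (w - z)).
{ intros w z; now rewrite <- Cminus_conj, Cmod_conj. }
destruct (disc_fun_extension f (fun w => Cconj (entry (B (Cconj w)) i j)) (f 0))
  as (F & HF & _ & _ & H1).
- intros w Hw; apply Df; lra.
- intros eps He.
  destruct (Df 0) as [l Hl]; [rewrite Cmod_0; lra|].
  destruct (cderiv_ccont _ _ _ Hl eps He) as (d & Hd & H).
  exists d; split; [exact Hd|]; intros w Hw; apply H.
  replace (w - 0) with w by ring; lra.
- intros z Hz eps He.
  destruct (boundary_value_Cmod _ _ _ (Cconj z) i j eps HB
    ltac:(now rewrite Cmod_conj) Hi Hj He) as (d & Hd & H).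
  exists d; split; [exact Hd|]; intros w Hw Hwz.
  unfold f; rewrite Hconj.
  apply (proj1 (H (Cconj w) ltac:(rewrite Hconj; exact Hwz))).
  unfold Defs.interior; rewrite Cmod_conj; lra.
- intros z Hz eps He.
  destruct (boundary_value_Cmod _ _ _ (Cconj z) i j eps HB
    ltac:(now rewrite Cmod_conj) Hi Hj He) as (d & Hd & H).
  exists d; split; [exact Hd|]; intros w Hw Hwz.
  rewrite Hconj.
  apply (proj2 (H (Cconj w) ltac:(rewrite Hconj; exact Hwz))).
  now rewrite Cmod_conj.
- now exists F.
Qed.

(** * The expansion of [Psi] at the origin and its derivative *)

Lemma Psi_of_derive (P : C -> M2) (f : C -> C) (l : C) :
  cderiv f 0 l -> f 0 = 0 -> (forall w, (0 < Cmod w < 1)%R -> f w = entry (P (/ w)) 0 1) ->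
  Psi_of P = 2 * Ci * l.
Proof.
intros (phi & Hc & Hl & d & Hd & Hphi) Hf0 Hf; unfold Psi_of; f_equal.
apply (@iota_filterlim_locally _ C_CompleteNormedModule _ C_infty).
{ apply Proper_StrongProper, C_infty_filter. }
apply filterlim_of_Cmod; intros eps He.
destruct (Hc eps He) as (d' & Hd' & Hc').
set (m := Rmin 1 (Rmin d d')).
assert (Hm : (0 < m)%R) by (unfold m; repeat apply Rmin_pos; lra).
exists (/ m)%R; intros L HL.
assert (Him : (0 < / m)%R) by now apply Rinv_0_lt_compat.
assert (HL0 : L <> 0) by (apply Cmod_gt_0_neq; lra).
assert (Hw : (0 < Cmod (/ L) < m)%R).
{ rewrite Cmod_inv by exact HL0; split; [apply Rinv_0_lt_compat; lra|].
  rewrite <- (Rinv_inv m); apply Rinv_lt_contravar; [|exact HL].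
  apply Rmult_lt_0_compat; lra. }
assert (Hm3 : (m <= 1 /\ m <= d /\ m <= d')%R).
{ unfold m; pose proof (Rmin_l 1 (Rmin d d')); pose proof (Rmin_r 1 (Rmin d d')).
  pose proof (Rmin_l d d'); pose proof (Rmin_r d d'); lra. }
assert (E0 : / L - 0 = / L) by ring.
(* Since [f 0 = 0], the product is f(w) / w at w = [/ L], that is, the slope function, which is
   continuous at 0 with value [l]. *)
replace (L * entry (P L) 0 1) with (phi (/ L)).
- rewrite <- Hl; apply Hc'; rewrite E0; lra.
- assert (EL : entry (P L) 0 1 = f (/ L)).
  { rewrite Hf by lra; do 2 f_equal; field; exact HL0. }
  rewrite EL.
  rewrite (Hphi (/ L)) by (rewrite E0; lra).
  rewrite E0, Hf0; field; exact HL0.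
Qed.

Lemma is_derive_of_quadratic (f : R -> C) (v : C) (K d : R) : (0 < d)%R ->
  (forall x : R, (Rabs x <= d)%R -> (Cmod (f x - f 0%R - x * v) <= K * x ^ 2)%R) ->
  @is_derive R_AbsRing C_R_NormedModule f 0%R v.
Proof.
intros Hd H; split; [apply is_linear_scal_l|].
intros x Hx.
apply (@is_filter_lim_locally_unique R_AbsRing (AbsRing_NormedModule R_AbsRing)) in Hx.
rewrite <- Hx.
intros eps; pose proof (cond_pos eps); pose proof (Rabs_pos K).
assert (Hm : (0 < Rmin d (eps / (Rabs K + 1)))%R).
{ apply Rmin_pos; [exact Hd|apply Rdiv_lt_0_compat; lra]. }
exists (mkposreal _ Hm); intros y Hy.
change (Rabs (y - 0) < Rmin d (eps / (Rabs K + 1)))%R in Hy.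
rewrite Rminus_0_r in Hy.
pose proof (Rmin_l d (eps / (Rabs K + 1))); pose proof (Rmin_r d (eps / (Rabs K + 1))).
assert (E : minus (minus (f y) (f 0%R)) (scal (minus y 0%R) v) = f y - f 0%R - y * v).
{ apply injective_projections; unfold minus, plus, opp, scal; simpl;
    unfold minus, plus, opp, scal, mult; simpl; unfold mult; simpl; ring. }
match goal with |- (?n <= _)%R => replace n with (Cmod (f y - f 0%R - y * v)) end.
2:{ rewrite <- E; unfold norm; simpl; unfold prod_norm, norm; simpl; unfold abs; simpl.
    unfold Cmod; rewrite <- (pow2_abs (fst _)), <- (pow2_abs (snd _)); reflexivity. }
match goal with |- (_ <= _ * ?n)%R => replace n with (Rabs y) end.
2:{ change (Rabs y = Rabs (y - 0)); now rewrite Rminus_0_r. }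
apply Rle_trans with (1 := H y ltac:(lra)).
assert (Hq : (Rabs y * (Rabs K + 1) <= eps)%R).
{ apply Rle_trans with (eps / (Rabs K + 1) * (Rabs K + 1))%R.
  - apply Rmult_le_compat_r; lra.
  - apply Req_le; field; lra. }
rewrite <- (pow2_abs y); pose proof (Rle_abs K); pose proof (Rabs_pos y).
apply Rle_trans with (Rabs y * (Rabs K + 1) * Rabs y)%R; [nra|].
apply Rmult_le_compat_r; [assumption|exact Hq].
Qed.

Lemma Psi_expansion (a b : C) (P : R -> R -> C -> M2) :
  a * Cconj a + b * Cconj b = 1 ->
  (forall X T : R, RHP_solution (mat22 a (Cconj b) (- b) (Cconj a)) X T (P X T)) ->
  exists K x0 : R, (0 < x0)%R /\ forall X : R, (Rabs X <= x0)%R ->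
    (Cmod (Psi_of (P X 0%R) - 8 * Cconj a * Cconj b
      - X * (32 * Cconj a * Cconj b * (b * Cconj b - a * Cconj a))) <= K * X ^ 2)%R.
Proof.
intros hab hP.
destruct (first_row_expansion a b hab) as (K & x0 & Hx0 & H).
exists (2 * K)%R, x0; split; [exact Hx0|]; intros X HX.
destruct (hP X 0%R) as (Ha & (Pp & Pm & Hp & Hm & Hj) & Hinf).
destruct (exterior_disc_fun _ Pp 0 0 ltac:(lia) ltac:(lia) Ha Hp Hinf) as (p1 & D1 & Z1 & _ & B1).
destruct (exterior_disc_fun _ Pp 0 1 ltac:(lia) ltac:(lia) Ha Hp Hinf) as (p2 & D2 & Z2 & E2 & B2).
destruct (interior_disc_fun _ Pm 0 0 ltac:(lia) ltac:(lia) Ha Hm) as (m1 & Dm1 & Bm1).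
destruct (interior_disc_fun _ Pm 0 1 ltac:(lia) ltac:(lia) Ha Hm) as (m2 & Dm2 & Bm2).
assert (Z1' : p1 0 = 1) by (rewrite Z1; reflexivity).
assert (Z2' : p2 0 = 0) by (rewrite Z2; reflexivity).
(* Conjugating these exponentials gives the diagonal entries of exp(-i Lambda X sigma_3) at Lambda =
   [Cconj w]. The two required relations then reduce to the unitarity of G. *)
destruct (H X p1 p2 (fun w => m1 w * Cexp (Ci * X * w)) (fun w => m2 w * Cexp (- (Ci * X) * w)))
  as (l & Hl & Hb); auto.
- apply disc_fun_mult; [exact Dm1|apply disc_fun_exp].
- apply disc_fun_mult; [exact Dm2|apply disc_fun_exp].
- intros w Hw.
  assert (Hi : / w = Cconj w).
  { assert (w <> 0) by (apply Cmod_gt_0_neq; lra).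
    transitivity (/ w * (w * Cconj w)); [rewrite Cmult_conj_circle by exact Hw; ring|now field]. }
  assert (Hi' : / Cconj w = w).
  { assert (Cconj w <> 0) by (apply Cmod_gt_0_neq; rewrite Cmod_conj; lra).
    transitivity (/ Cconj w * (w * Cconj w)); [rewrite Cmult_conj_circle by exact Hw; ring|now field]. }
  assert (Hc : circle (Cconj w)) by (unfold circle; now rewrite Cmod_conj).
  destruct (entry_mul_jump (Pm (Cconj w)) a (Cconj b) (- b) (Cconj a) X (Cconj w)) as [J1 J2].
  rewrite <- (Hj _ Hc), <- Hi, <- B1, Hi, Hi' in J1 by exact Hw.
  rewrite <- (Hj _ Hc), <- Hi, <- B2, Hi, Hi' in J2 by exact Hw.
  rewrite J1, J2, Bm1, Bm2 by exact Hw.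
  rewrite !Cmult_conj, !Cconj_conj, !Cexp_conj.
  set (x := entry (Pm (Cconj w)) 0 0); set (y := entry (Pm (Cconj w)) 0 1).
  set (v := Cconj w); set (a' := Cconj a); set (b' := Cconj b).
  assert (Hk : Cconj (Ci * X * w) = - (Ci * X * v)).
  { unfold v; apply injective_projections; simpl; ring. }
  assert (Hk' : Cconj (- (Ci * X) * w) = Ci * X * v).
  { unfold v; apply injective_projections; simpl; ring. }
  rewrite Hk, Hk'.
  assert (H2 : forall z, Cexp (2 * z) = Cexp z * Cexp z).
  { intros z; rewrite <- Cexp_plus; f_equal; ring. }
  replace (2 * Ci * X * v) with (2 * (Ci * X * v)) by ring.
  replace (- (4 * Ci) * w) with (- (4 * Ci * w)) by ring.
  rewrite !Cexp_opp, !H2.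
  set (t := Cexp (Ci * X * v)); set (e := Cexp (4 * Ci * w)).
  assert (Ht : t <> 0) by apply Cexp_neq_0; assert (He : e <> 0) by apply Cexp_neq_0.
  split.
  + transitivity (x * / t * (a * a' + b * b')); [unfold a', b'; rewrite hab; ring|field; now split].
  + transitivity (y * t * (a * a' + b * b')); [unfold a', b'; rewrite hab; ring|field; now split].
- rewrite (Psi_of_derive _ p2 l Hl Z2' E2).
  replace (2 * Ci * l - _ - _) with (2 * Ci * (l - - (4) * Ci * Cconj a * Cconj b
    - X * (16 * Ci * Cconj a * Cconj b * (a * Cconj a - b * Cconj b)))).
  + rewrite Cmod_mult, Cmod_mult, Cmod_Ci, Cmod_R, Rabs_pos_eq by lra; lra.
  + assert (Hi : Ci * Ci = - (1)) by (apply injective_projections; simpl; ring).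
    transitivity (2 * Ci * l + 8 * (Ci * Ci) * Cconj a * Cconj b
      - X * (32 * (Ci * Ci) * Cconj a * Cconj b * (a * Cconj a - b * Cconj b))); [ring|].
    rewrite Hi; ring.
Qed.

Lemma norm2_pos (a b : C) : ~ (a = 0 /\ b = 0) ->
  (0 < norm2 a b)%R /\ (norm2 a b ^ 2 = Cmod a ^ 2 + Cmod b ^ 2)%R.
Proof.
intros hab.
pose proof (pow2_ge_0 (Cmod a)); pose proof (pow2_ge_0 (Cmod b)).
split; unfold norm2; [|apply pow2_sqrt; lra].
apply sqrt_lt_R0.
destruct (Ceq_dec a 0) as [Ha|Ha]; [destruct (Ceq_dec b 0) as [Hb|Hb]; [tauto|]|].
- apply Cmod_gt_0 in Hb; nra.
- apply Cmod_gt_0 in Ha; nra.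
Qed.

Theorem theorem1p7 (a b : C) (hab : ~ (a = 0 /\ b = 0))
    (P : R -> R -> C -> M2)
    (hP : forall X T : R, RHP_solution (Gmat a b) X T (P X T)) :
  let Psi := fun X T : R => Psi_of (P X T) in
  let fa := (Cmod a / norm2 a b)%R in
  let fb := (Cmod b / norm2 a b)%R in
  let value :=
    32 * Cconj a * Cconj b *
      ((Cmod b ^ 2 - Cmod a ^ 2) / (Cmod a ^ 2 + Cmod b ^ 2) ^ 2)%R in
  @is_derive R_AbsRing C_R_NormedModule (fun X : R => Psi X 0%R) 0%R value /\
  (forall t : R, is_arg (a * b) t ->
     32 * Cexp (- Ci * t) * (fa * fb * (fb ^ 2 - fa ^ 2))%R = value).
Proof.
intros Psi fa fb value.
destruct (norm2_pos a b hab) as [Hn Hn2].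
set (n := norm2 a b) in *.
assert (Hn0 : RtoC n <> 0) by (intros Hc; apply RtoC_inj in Hc; lra).
assert (Hv : value = 32 * Cconj a * Cconj b * (b * Cconj b - a * Cconj a) / n ^ 4).
{ unfold value; rewrite <- Hn2.
  replace ((Cmod b ^ 2 - Cmod a ^ 2) / (n ^ 2) ^ 2)%R
    with ((Cmod b ^ 2 - Cmod a ^ 2) * / n ^ 4)%R by (field; lra).
  rewrite RtoC_mult, RtoC_minus, !Cmod2_conj, RtoC_inv, RtoC_pow by (apply pow_nonzero; lra).
  unfold Cdiv; ring. }
assert (Hconj : forall z, Cconj (z / n) = Cconj z / n).
{ intros z; rewrite Cdiv_conj by exact Hn0; f_equal; apply injective_projections; simpl; ring. }
split.
- assert (H1 : a / n * Cconj (a / n) + b / n * Cconj (b / n) = 1).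
  { rewrite !Hconj.
    transitivity ((a * Cconj a + b * Cconj b) / (n ^ 2)); [field; exact Hn0|].
    rewrite <- !Cmod2_conj, <- RtoC_plus, <- Hn2, RtoC_pow; field; exact Hn0. }
  destruct (Psi_expansion (a / n) (b / n) P H1) as (K & x0 & Hx0 & H).
  { intros X T; rewrite !Hconj.
    replace (- (b / n)) with (- b / n) by (field; exact Hn0).
    exact (hP X T). }
  apply is_derive_of_quadratic with K x0; [exact Hx0|]; intros X HX.
  (* At [X = 0] the error bound is 0, so the constant term of the expansion is the exact value at
     the origin. *)
  assert (HK0 : Psi_of (P 0%R 0%R) = 8 * Cconj (a / n) * Cconj (b / n)).
  { specialize (H 0%R ltac:(rewrite Rabs_R0; lra)).
    rewrite Cmult_0_l, pow_i, Rmult_0_r in H by lia.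
    apply Ceq_minus, Cmod_eq_0, Rle_antisym; [|apply Cmod_ge_0].
    match goal with |- (Cmod ?z <= _)%R => now replace z with (z - 0) by ring end. }
  apply Rle_trans with (2 := H X HX), Req_le; unfold Psi; rewrite HK0; f_equal; f_equal; f_equal.
  rewrite Hv, !Hconj; field; exact Hn0.
- intros t Ht; rewrite Hv.
  unfold is_arg in Ht.
  assert (Hc : Cconj a * Cconj b = Cmod (a * b) * Cexp (- Ci * t)).
  { rewrite <- Cmult_conj, Ht at 1.
    rewrite Cmult_conj, Cexp_conj; f_equal; [|f_equal];
      apply injective_projections; simpl; ring. }
  unfold fa, fb; fold n.
  replace (Cmod a / n * (Cmod b / n) * ((Cmod b / n) ^ 2 - (Cmod a / n) ^ 2))%R
    with (Cmod (a * b) * (Cmod b ^ 2 - Cmod a ^ 2) * / n ^ 4)%R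
    by (rewrite Cmod_mult; field; lra).
  rewrite !RtoC_mult, RtoC_minus, !Cmod2_conj, RtoC_inv, RtoC_pow by (apply pow_nonzero; lra).
  transitivity (32 * (Cmod (a * b) * Cexp (- Ci * t)) * (b * Cconj b - a * Cconj a) * / n ^ 4);
    [ring|].
  rewrite <- Hc; unfold Cdiv; ring.
Qed.
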